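(* Let $\Lambda$ be an Artin algebra. Then $$\mathrm{tri.dim}\, D_{sg}(\mathrm{mod}\,\Lambda)\leqslant \mathrm{IT.dist}\,\Lambda .$$
   Context: For an Artin algebra $\Lambda$, $\mathrm{mod}\,\Lambda$ is the category of finitely generated $\Lambda$-modules (on a fixed side). The singularity category is the Verdier quotient $D_{sg}(\mathrm{mod}\,\Lambda):=D^b(\mathrm{mod}\,\Lambda)/K^b(\mathrm{proj}\,\Lambda)$, where $K^b(\mathrm{proj}\,\Lambda)$ is the bounded homotopy category of finitely generated projective modules. Dimension of a triangulated category $\mathcal T$: for a class $\mathcal I$ of objects of $\mathcal T$, let $\langle\mathcal I\rangle_1$ be the full subcategory of all direct summands of finite direct sums of shifts of objects in $\mathcal I$. For classes $\mathcal I_1,\mathcal I_2$ let $\mathcal I_1*\mathcal I_2$ be the full subcategory of objects $X$ for which there is a distinguished triangle $X_1\to X\to X_2\to X_1[1]$ with $X_1\in\mathcal I_1$, $X_2\in\mathcal I_2$, and let $\mathcal I_1\diamond\mathcal I_2:=\langle\mathcal I_1*\mathcal I_2\rangle_1$. Put $\langle\mathcal I\rangle_0:=0$ and $\langle\mathcal I\rangle_{n+1}:=\langle\mathcal I\rangle_n\diamond\langle\mathcal I\rangle_1$ for $n\ge 1$; for an object $M$ write $\langle M\rangle_n$ for $\langle\{M\}\rangle_n$. Then $\mathrm{tri.dim}\,\mathcal T$ is the minimal integer $d\ge 0$ such that there is an object $M\in\mathcal T$ with $\mathcal T=\langle M\rangle_{d+1}$, and $\mathrm{tri.dim}\,\mathcal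 T=\infty$ if no such $M$ exists for any $d$. For $V\in\mathrm{mod}\,\Lambda$, $\mathrm{add}\,V$ is the full subcategory of direct summands of finite direct sums of copies of $V$. For $X\in \mathrm{mod}\,\Lambda$, $\Omega^0(X)=X$, $\Omega^1(X)$ is the kernel of a projective cover $P\to X$, and $\Omega^n(X)=\Omega^1(\Omega^{n-1}(X))$ for $n\ge 2$. $(m,n)$-Igusa-Todorov algebra: for integers $m,n\ge 0$, $\Lambda$ is an $(m,n)$-Igusa-Todorov algebra if there is a module $V\in\mathrm{mod}\,\Lambda$ such that for every $M\in\mathrm{mod}\,\Lambda$ there is an exact sequence $$0\to V_m\to V_{m-1}\to\cdots\to V_1\to V_0\to\Omega^n(M)\to 0$$ with $V_i\in\mathrm{add}\,V$ for all $0\le i\le m$. Igusa-Todorov distance: $\mathrm{IT.dist}\,\Lambda:=\inf\bigcup_{n=0}^{\infty}\{m\ge 0 \mid \Lambda\text{ is an }(m,n)\text{-Igusa-Todorov algebra}\}$. *)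

(* Defs.v *)
From HB Require Import structures.
From mathcomp Require Import all_boot all_order all_algebra.
From mathcomp Require Import boolp.
From mathcomp Require Import zify.
Set Implicit Arguments. Unset Strict Implicit. Unset Printing Implicit Defensive.
Import Order.TTheory GRing.Theory.
Local Open Scope ring_scope.

(* [None] stands for infinity. *)
Definition enat := option nat.

Definition enat_le (a b : enat) : bool :=
  match a, b with
  | _, None => true
  | None, Some _ => false
  | Some m, Some n => (m <= n)%N
  end.

Definition enat_inf (A : nat -> Prop) : enat :=
  match pselect (exists n, `[< A n >]) with
  | left h => Some (ex_minn h)
  | right _ => None
  end.

(* Equality of parallel morphisms is carried by the relation [heq] (homotopy of
   chain maps, equality in a localization), and not by Leibniz equality. *)
Record shcat := ShCat {
  ob :> Type;
  hom : ob -> ob -> Type;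
  heq : forall X Y, hom X Y -> hom X Y -> Prop;
  idm : forall X, hom X X;
  cmp : forall X Y Z, hom Y Z -> hom X Y -> hom X Z;
  sh : int -> ob -> ob;
  shm : forall (n : int) X Y, hom X Y -> hom (sh n X) (sh n Y);
  heq_refl : forall X Y (f : hom X Y), heq f f;
  heq_sym : forall X Y (f g : hom X Y), heq f g -> heq g f;
  heq_trans : forall X Y (f g h : hom X Y), heq f g -> heq g h -> heq f h;
  cmp_heq : forall X Y Z (g g' : hom Y Z) (f f' : hom X Y),
    heq g g' -> heq f f' -> heq (cmp g f) (cmp g' f');
  cmpA : forall X Y Z W (h : hom Z W) (g : hom Y Z) (f : hom X Y),
    heq (cmp h (cmp g f)) (cmp (cmp h g) f);
  cmp1l : forall X Y (f : hom X Y), heq (cmp (idm Y) f) f;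
  cmp1r : forall X Y (f : hom X Y), heq (cmp f (idm X)) f;
  shm_heq : forall n X Y (f g : hom X Y), heq f g -> heq (shm n f) (shm n g);
  shm_id : forall n X, heq (shm n (idm X)) (idm (sh n X));
  shm_cmp : forall n X Y Z (g : hom Y Z) (f : hom X Y),
    heq (shm n (cmp g f)) (cmp (shm n g) (shm n f))
}.

Arguments hom {s} _ _.
Arguments heq {s X Y} _ _.
Arguments idm {s} X.
Arguments cmp {s X Y Z} _ _.
Arguments sh {s} n X.
Arguments shm {s} n {X Y} _.
Arguments heq_refl {s X Y} f.
Arguments heq_sym {s X Y f g} _.
Arguments heq_trans {s X Y f g h} _ _.
Arguments cmp_heq {s X Y Z g g' f f'} _ _.
Arguments cmpA {s X Y Z W} h g f.
Arguments cmp1l {s X Y} f.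
Arguments cmp1r {s X Y} f.
Arguments shm_heq {s} n {X Y f g} _.
Arguments shm_id {s} n X.
Arguments shm_cmp {s} n {X Y Z} g f.

Section Basics.
Variable C : shcat.

Definition mutual_inv (X Y : C) (f : hom X Y) (g : hom Y X) : Prop :=
  heq (cmp g f) (idm X) /\ heq (cmp f g) (idm Y).

Definition is_iso (X Y : C) (f : hom X Y) : Prop := exists g, mutual_inv f g.

Definition isomorphic (X Y : C) : Prop := exists f : hom X Y, is_iso f.

Definition is_zero (X : C) : Prop :=
  forall Y : C, (exists f : hom X Y, forall g, heq f g) /\
                (exists f : hom Y X, forall g, heq f g).

(* In an additive category finite coproducts are the direct sums. *)
Definition is_coprod2 (X Y S : C) (i : hom X S) (j : hom Y S) : Prop :=
  forall (Z : C) (f : hom X Z) (g : hom Y Z),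
    exists u : hom S Z,
      [/\ heq (cmp u i) f, heq (cmp u j) g
        & forall v : hom S Z,
            heq (cmp v i) f -> heq (cmp v j) g -> heq v u].

Definition is_coprod (r : nat) (X : 'I_r -> C) (S : C)
    (i : forall a, hom (X a) S) : Prop :=
  forall (Z : C) (f : forall a, hom (X a) Z),
    exists u : hom S Z,
      (forall a, heq (cmp u (i a)) (f a)) /\
      (forall v : hom S Z, (forall a, heq (cmp v (i a)) (f a)) -> heq v u).

Definition summand (X S : C) : Prop :=
  exists (Y : C) (i : hom X S) (j : hom Y S), is_coprod2 i j.

Definition tri_class : Type :=
  forall X Y Z : C, hom X Y -> hom Y Z -> hom Z (sh 1 X) -> Prop.

Definition tri_iso (X Y Z : C) (f : hom X Y) (g : hom Y Z) (h : hom Z (sh 1 X))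
    (X' Y' Z' : C) (f' : hom X' Y') (g' : hom Y' Z') (h' : hom Z' (sh 1 X'))
    : Prop :=
  exists (a : hom X X') (b : hom Y Y') (c : hom Z Z'),
    [/\ is_iso a, is_iso b & is_iso c] /\
    [/\ heq (cmp b f) (cmp f' a), heq (cmp c g) (cmp g' b)
      & heq (cmp (shm 1 a) h) (cmp h' c)].

Definition tri_closure (D : tri_class) : tri_class :=
  fun X Y Z f g h =>
    exists (X' Y' Z' : C) (f' : hom X' Y') (g' : hom Y' Z')
           (h' : hom Z' (sh 1 X')), D _ _ _ f' g' h' /\ tri_iso f' g' h' f g h.

Lemma is_iso_shm n (X Y : C) (f : hom X Y) : is_iso f -> is_iso (shm n f).
Proof.
case=> g [gf fg]; exists (shm n g); split.
  exact: heq_trans (heq_sym (shm_cmp n g f)) (heq_trans (shm_heq n gf) (shm_id n X)).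
exact: heq_trans (heq_sym (shm_cmp n f g)) (heq_trans (shm_heq n fg) (shm_id n Y)).
Qed.

Lemma is_iso_cmp (X Y Z : C) (g : hom Y Z) (f : hom X Y) :
  is_iso g -> is_iso f -> is_iso (cmp g f).
Proof.
move=> [g' [g'g gg']] [f' [f'f ff']]; exists (cmp f' g'); split.
  apply: heq_trans (cmpA _ _ _) _.
  apply: heq_trans (cmp_heq (heq_sym (cmpA f' g' g)) (heq_refl f)) _.
  apply: heq_trans (cmp_heq (cmp_heq (heq_refl f') g'g) (heq_refl f)) _.
  exact: heq_trans (cmp_heq (cmp1r f') (heq_refl f)) f'f.
apply: heq_trans (cmpA _ _ _) _.
apply: heq_trans (cmp_heq (heq_sym (cmpA g f f')) (heq_refl g')) _.
apply: heq_trans (cmp_heq (cmp_heq (heq_refl g) ff') (heq_refl g')) _.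
exact: heq_trans (cmp_heq (cmp1r g) (heq_refl g')) gg'.
Qed.

Lemma is_iso_idm (X : C) : is_iso (idm X).
Proof. by exists (idm X); split; apply: cmp1l. Qed.

Lemma isomorphic_shm n (X Y : C) :
  isomorphic X Y -> isomorphic (sh n X) (sh n Y).
Proof. by case=> f fi; exists (shm n f); apply: is_iso_shm. Qed.

Lemma tri_closure_shift (D : tri_class) (n : int) :
  (forall X Y Z (f : hom X Y) (g : hom Y Z) (h : hom Z (sh 1 X)),
     D _ _ _ f g h ->
     exists h', tri_closure D (shm n f) (shm n g) h') ->
  forall X Y Z (f : hom X Y) (g : hom Y Z) (h : hom Z (sh 1 X)),
    tri_closure D f g h -> exists h', tri_closure D (shm n f) (shm n g) h'.
Proof.
move=> HD X Y Z f g h [X0 [Y0 [Z0 [f0 [g0 [h0 [D0]]]]]]].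
case=> a [b [c [[ai bi ci] [ef eg _]]]].
have [h0' [X1 [Y1 [Z1 [f1 [g1 [h1 [D1]]]]]]]] := HD _ _ _ _ _ _ D0.
case=> a1 [b1 [c1 [[a1i b1i c1i] [ef1 eg1 eh1]]]].
have [k [kc ck]] := is_iso_shm n ci.
exists (cmp (shm 1 (shm n a)) (cmp h0' k)).
exists X1, Y1, Z1, f1, g1, h1; split=> //.
exists (cmp (shm n a) a1), (cmp (shm n b) b1), (cmp (shm n c) c1).
split; first by split; apply: is_iso_cmp => //; apply: is_iso_shm.
have sq (A B A1 B1 A2 B2 : C) (u : hom A B) (u1 : hom A1 B1) (u2 : hom A2 B2)
    (p : hom A A1) (q : hom B B1) (p' : hom A1 A2) (q' : hom B1 B2) :
    heq (cmp q u) (cmp u1 p) -> heq (cmp q' u1) (cmp u2 p') ->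
    heq (cmp (cmp q' q) u) (cmp u2 (cmp p' p)).
  move=> e e'; apply: heq_trans (heq_sym (cmpA _ _ _)) _.
  apply: heq_trans (cmp_heq (heq_refl q') e) _.
  apply: heq_trans (cmpA _ _ _) _.
  apply: heq_trans (cmp_heq e' (heq_refl p)) _.
  exact: heq_sym (cmpA _ _ _).
have shsq (A B A1 B1 : C) (u : hom A B) (u1 : hom A1 B1)
    (p : hom A A1) (q : hom B B1) :
    heq (cmp q u) (cmp u1 p) ->
    heq (cmp (shm n q) (shm n u)) (cmp (shm n u1) (shm n p)).
  move=> e; apply: heq_trans (heq_sym (shm_cmp _ _ _)) _.
  exact: heq_trans (shm_heq n e) (shm_cmp _ _ _).
split; [exact: sq ef1 (shsq _ _ _ _ _ _ _ _ ef)|exact: sq eg1 (shsq _ _ _ _ _ _ _ _ eg)|].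
apply: heq_trans (cmp_heq (shm_cmp 1 (shm n a) a1) (heq_refl h1)) _.
apply: sq eh1 _.
apply: heq_trans _ (cmpA _ _ _); apply: cmp_heq; first exact: heq_refl.
apply: heq_trans _ (cmpA _ _ _).
apply: heq_trans (heq_sym (cmp1r h0')) _.
by apply: cmp_heq; [exact: heq_refl|exact: heq_sym].
Qed.

End Basics.

(* The data entering the definitions of Verdier quotients and of the dimension;
   of the axioms of a triangulated category only the consequence [dist_shift]
   of the rotation axiom is recorded, since it makes the shift descend to
   localizations. *)
Record tricat := TriCat {
  tri_cat :> shcat;
  dist : tri_class tri_cat;
  dist_shift : forall n (X Y Z : tri_cat) (f : hom X Y) (g : hom Y Z)
    (h : hom Z (sh 1 X)),
    dist f g h -> exists h', dist (shm n f) (shm n g) h'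
}.

Arguments dist {t X Y Z} _ _ _.

Section Verdier.
Variables (T : tricat) (N : T -> Prop).
Hypothesis N_sh : forall n X, N X -> N (sh n X).

Definition cone_in (X Y : T) (s : hom X Y) : Prop :=
  exists (Z : T) (g : hom Y Z) (h : hom Z (sh 1 X)), dist s g h /\ N Z.

Lemma cone_in_shm n (X Y : T) (s : hom X Y) : cone_in s -> cone_in (shm n s).
Proof.
case=> Z [g [h [D NZ]]]; have [h' D'] := dist_shift n D.
by exists (sh n Z), (shm n g), h'; split=> //; apply: N_sh.
Qed.

(* The Gabriel-Zisman localization of [T] at the morphisms with cone in [N]:
   formal composites of morphisms of [T] and of inverses of such morphisms,
   modulo the congruence [lheq].  Its distinguished triangles are those
   isomorphic to images of distinguished triangles of [T]. *)
Inductive lhom : T -> T -> Type :=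
| Linj X Y : hom X Y -> lhom X Y
| Linv X Y (s : hom X Y) : cone_in s -> lhom Y X
| Lcmp X Y Z : lhom Y Z -> lhom X Y -> lhom X Z.

Inductive lheq : forall X Y, lhom X Y -> lhom X Y -> Prop :=
| lheq_refl X Y (f : lhom X Y) : lheq f f
| lheq_sym X Y (f g : lhom X Y) : lheq f g -> lheq g f
| lheq_trans X Y (f g h : lhom X Y) : lheq f g -> lheq g h -> lheq f h
| lheq_cmp X Y Z (g g' : lhom Y Z) (f f' : lhom X Y) :
    lheq g g' -> lheq f f' -> lheq (Lcmp g f) (Lcmp g' f')
| lheqA X Y Z W (h : lhom Z W) (g : lhom Y Z) (f : lhom X Y) :
    lheq (Lcmp h (Lcmp g f)) (Lcmp (Lcmp h g) f)
| lheq1l X Y (f : lhom X Y) : lheq (Lcmp (Linj (idm Y)) f) f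
| lheq1r X Y (f : lhom X Y) : lheq (Lcmp f (Linj (idm X))) f
| lheq_inj X Y (f g : hom X Y) : heq f g -> lheq (Linj f) (Linj g)
| lheq_injM X Y Z (g : hom Y Z) (f : hom X Y) :
    lheq (Linj (cmp g f)) (Lcmp (Linj g) (Linj f))
| lheqVl X Y (s : hom X Y) (hs : cone_in s) :
    lheq (Lcmp (Linv hs) (Linj s)) (Linj (idm X))
| lheqVr X Y (s : hom X Y) (hs : cone_in s) :
    lheq (Lcmp (Linj s) (Linv hs)) (Linj (idm Y)).

Fixpoint lshm n X Y (f : lhom X Y) : lhom (sh n X) (sh n Y) :=
  match f with
  | Linj _ _ f => Linj (shm n f)
  | Linv _ _ _ hs => Linv (cone_in_shm n hs)
  | Lcmp _ _ _ g f => Lcmp (lshm n g) (lshm n f)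
  end.

Lemma lshm_id n X : lheq (lshm n (Linj (idm X))) (Linj (idm (sh n X))).
Proof. exact/lheq_inj/shm_id. Qed.

Lemma lshm_heq n X Y (f g : lhom X Y) : lheq f g -> lheq (lshm n f) (lshm n g).
Proof.
elim=> {X Y f g} /=.
- by move=> *; apply: lheq_refl.
- by move=> *; apply: lheq_sym.
- by move=> X Y f g h _ fg _ gh; apply: lheq_trans fg gh.
- by move=> *; apply: lheq_cmp.
- by move=> *; apply: lheqA.
- move=> X Y f; apply: lheq_trans (lheq_cmp (lshm_id n Y) (lheq_refl _)) _.
  exact: lheq1l.
- move=> X Y f; apply: lheq_trans (lheq_cmp (lheq_refl _) (lshm_id n X)) _.
  exact: lheq1r.
- by move=> *; apply/lheq_inj/shm_heq.
- move=> X Y Z g f; apply: lheq_trans (lheq_injM _ _).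
  exact/lheq_inj/shm_cmp.
- by move=> X Y s hs; apply: lheq_trans (lheqVl _) (lheq_sym (lshm_id n X)).
- by move=> X Y s hs; apply: lheq_trans (lheqVr _) (lheq_sym (lshm_id n Y)).
Qed.

Definition loc_cat : shcat :=
  @ShCat (ob T) lhom lheq (fun X => Linj (idm X)) Lcmp (@sh T) lshm
    lheq_refl lheq_sym lheq_trans lheq_cmp lheqA lheq1l lheq1r
    lshm_heq lshm_id (fun n X Y Z g f => lheq_refl _).

Inductive image_tri : tri_class loc_cat :=
| ImageTri (X Y Z : T) (f : hom X Y) (g : hom Y Z) (h : hom Z (sh 1 X)) :
    dist f g h ->
    @image_tri X Y Z (Linj f) (Linj g) (Linj h).

Lemma loc_dist_shift n (X Y Z : loc_cat) (f : hom X Y) (g : hom Y Z)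
    (h : hom Z (sh 1 X)) :
  tri_closure image_tri f g h ->
  exists h', tri_closure image_tri (shm n f) (shm n g) h'.
Proof.
apply: tri_closure_shift => {f g h}X' Y' Z' f g h [{}X {}Y {}Z f0 g0 h0 D].
have [h' D'] := dist_shift n D; exists (Linj h').
exists (sh n X), (sh n Y), (sh n Z), (Linj (shm n f0)), (Linj (shm n g0)), (Linj h').
split; first exact: (ImageTri D').
exists (idm (_ : loc_cat)), (idm (_ : loc_cat)), (idm (_ : loc_cat)).
split; first by split; apply: is_iso_idm.
have id_sq (A B : loc_cat) (u : hom A B) : heq (cmp (idm B) u) (cmp u (idm A)).
  exact: heq_trans (cmp1l u) (heq_sym (cmp1r u)).
split; try exact: id_sq.
apply: heq_trans (cmp_heq (shm_id 1 _) (heq_refl _)) _; exact: id_sq.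
Qed.

Definition verdier : tricat := TriCat loc_dist_shift.

End Verdier.

Section Dimension.
Variable T : tricat.

Definition gen1 (I : T -> Prop) (X : T) : Prop :=
  exists (r : nat) (M : 'I_r -> T) (n : 'I_r -> int) (S : T)
         (i : forall a, hom (sh (n a) (M a)) S),
    [/\ forall a, I (M a), is_coprod i & summand X S].

Definition star (I1 I2 : T -> Prop) (X : T) : Prop :=
  exists (X1 X2 : T) (f : hom X1 X) (g : hom X X2) (h : hom X2 (sh 1 X1)),
    [/\ I1 X1, I2 X2 & dist f g h].

Definition diamond (I1 I2 : T -> Prop) : T -> Prop := gen1 (star I1 I2).

Fixpoint gen (I : T -> Prop) (n : nat) : T -> Prop :=
  match n with
  | 0 => @is_zero T
  | 1 => gen1 I
  | n'.+1 => diamond (gen I n') (gen1 I)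
  end.

Definition tri_dim : enat :=
  enat_inf (fun d => exists M : T, forall X : T, gen (fun Y => Y = M) d.+1 X).

End Dimension.

Definition fin_gen (R : pzRingType) (M : lmodType R) : Prop :=
  exists (n : nat) (g : 'I_n -> M),
    forall x, exists c : 'I_n -> R, x = \sum_i c i *: g i.

Definition is_ideal (k : comPzRingType) (I : k -> Prop) : Prop :=
  [/\ I 0, forall x y, I x -> I y -> I (x + y) & forall a x, I x -> I (a * x)].

Definition artinian (k : comPzRingType) : Prop :=
  forall I : nat -> k -> Prop,
    (forall n, is_ideal (I n)) -> (forall n x, I n.+1 x -> I n x) ->
    exists N, forall n, (N <= n)%N -> forall x, I N x -> I n x.

Definition artin_algebra (k : comPzRingType) (L : algType k) : Prop :=
  artinian k /\ fin_gen L.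

Record fgmod (R : pzRingType) := FgMod {
  fg_carrier :> lmodType R;
  fg_prop : fin_gen fg_carrier
}.

Section Modules.
Variable R : pzRingType.

Definition surj (M N : lmodType R) (f : {linear M -> N}) : Prop :=
  forall y, exists x, f x = y.

Definition exact_at (M N P : lmodType R) (f : {linear M -> N})
    (g : {linear N -> P}) : Prop :=
  forall y, g y = 0 <-> exists x, f x = y.

Definition mod_iso (M N : lmodType R) : Prop :=
  exists f : {linear M -> N}, bijective f.

Definition projective (P : lmodType R) : Prop :=
  forall (M N : lmodType R) (g : {linear M -> N}) (f : {linear P -> N}),
    surj g -> exists h : {linear P -> M}, forall x, g (h x) = f x.

Definition is_submod (M : lmodType R) (N : M -> Prop) : Prop :=
  [/\ N 0, forall x y, N x -> N y -> N (x + y) & forall a x, N x -> N (a *: x)].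

Definition superfluous (M : lmodType R) (K : M -> Prop) : Prop :=
  forall N : M -> Prop, is_submod N ->
    (forall x, exists y z, [/\ N y, K z & x = y + z]) -> forall x, N x.

Definition proj_cover (P M : lmodType R) (p : {linear P -> M}) : Prop :=
  [/\ projective P, surj p & superfluous (fun x => p x = 0)].

(* [is_syzygy n M K] : the module [K] is the [n]-th syzygy of [M], which is
   defined up to isomorphism. *)
Fixpoint is_syzygy (n : nat) (M K : fgmod R) : Prop :=
  match n with
  | 0 => mod_iso M K
  | n'.+1 =>
      exists (M' P : fgmod R) (i : {linear K -> P}) (p : {linear P -> M'}),
        [/\ is_syzygy n' M M', proj_cover p, injective i & exact_at i p]
  end.

Definition in_add (V X : fgmod R) : Prop :=
  exists (r : nat) (Y : fgmod R), mod_iso (X * Y)%type {ffun 'I_r -> V}.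

(* The exact sequence is indexed by all of [nat], with zero modules in degrees
   above [m]. *)
Definition IT_algebra (m n : nat) : Prop :=
  exists V : fgmod R, forall M : fgmod R,
    exists K : fgmod R, is_syzygy n M K /\
    exists (W : nat -> fgmod R) (d : forall i, {linear W i.+1 -> W i})
           (e : {linear W 0 -> K}),
      [/\ forall i, (i <= m)%N -> in_add V (W i),
          forall i, (m < i)%N -> forall x : W i, x = 0,
          forall i, exact_at (d i.+1) (d i),
          exact_at (d 0) e
        & surj e].

Definition IT_dist : enat := enat_inf (fun m => exists n, IT_algebra m n).

Lemma fin_gen_prod (M N : fgmod R) : fin_gen (M * N)%type.
Proof.
case: M N => [M [m [g gP]]] [N [n [h hP]]] /=.
exists (m + n)%N, (fun a => match split a with
  inl i => (g i, 0) | inr j => (0, h j) end) => -[x y].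
have [c cP] := gP x; have [c' c'P] := hP y.
exists (fun a => match split a with inl i => c i | inr j => c' j end).
rewrite big_split_ord /=.
under eq_bigr do rewrite (unsplitK (inl _)).
under [X in _ + X]eq_bigr do rewrite (unsplitK (inr _)).
have E1 (F : 'I_m -> M) : \sum_i (F i, 0 : N) = (\sum_i F i, 0).
  by elim/big_rec2: _ => // i a b _ ->; congr pair; rewrite addr0.
have E2 (F : 'I_n -> N) : \sum_i (0 : M, F i) = (0, \sum_i F i).
  by elim/big_rec2: _ => // i a b _ ->; congr pair; rewrite addr0.
transitivity (((\sum_i c i *: g i, 0) : M * N) + (0, \sum_i c' i *: h i)).
  by rewrite -cP -c'P; congr pair; rewrite ?addr0 ?add0r.
rewrite -E1 -E2; congr (_ + _); apply: eq_bigr => i _;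
  by congr pair; rewrite /= scaler0.
Qed.

Definition fg_prod (M N : fgmod R) : fgmod R := FgMod (fin_gen_prod M N).

End Modules.

(* Bounded complexes of finitely generated left modules, with cohomological
   indexing.  The differential is given for every pair of degrees
   and vanishes unless the target degree is the source degree plus one; this
   avoids transports along equalities of degrees in shifts. *)
Record cpx (R : pzRingType) := Cpx {
  cob :> int -> fgmod R;
  cd : forall i j, {linear cob i -> cob j};
  cd_shape : forall i j, i + 1 <> j -> forall x, cd i j x = 0;
  cd_sq : forall i j k x, cd j k (cd i j x) = 0;
  cbnd : exists N : nat, forall i : int, (N < `|i|)%N -> forall x : cob i, x = 0
}.

Record chmap (R : pzRingType) (X Y : cpx R) := ChMap {
  cm :> forall i, {linear X i -> Y i};
  cm_d : forall i j x, cm j (cd X i j x) = cd Y i j (cm i x)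
}.

Section Complexes.
Variable R : pzRingType.
Implicit Types X Y Z : cpx R.

Definition homotopic X Y (f g : chmap X Y) : Prop :=
  exists h : forall i j, {linear X i -> Y j},
    forall p i q : int, p + 1 = i -> i + 1 = q -> forall x : X i,
      f i x - g i x = cd Y p i (h i p x) + h q i (cd X i q x).

Lemma homotopic_refl X Y (f : chmap X Y) : homotopic f f.
Proof.
exists (fun i j => \0) => p i q _ _ x; by rewrite /= subrr raddf0 addr0.
Qed.

Lemma homotopic_eq X Y (f g : chmap X Y) :
  (forall i x, f i x = g i x) -> homotopic f g.
Proof.
move=> fg; have [h hP] := homotopic_refl g; exists h => p i q pi iq x.
by rewrite fg; apply: hP.
Qed.

Lemma homotopic_sym X Y (f g : chmap X Y) : homotopic f g -> homotopic g f.
Proof.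
case=> h hP; exists (fun i j => \- h i j) => p i q pi iq x /=.
by rewrite raddfN -opprD -hP // opprB.
Qed.

Lemma homotopic_trans X Y (f g k : chmap X Y) :
  homotopic f g -> homotopic g k -> homotopic f k.
Proof.
case=> h hP [h' h'P]; exists (fun i j => h i j \+ h' i j) => p i q pi iq x /=.
by rewrite raddfD /= addrACA -hP // -h'P // addrA subrK.
Qed.

Definition ch_id X : chmap X X :=
  @ChMap R X X (fun i => idfun) (fun i j x => erefl).

Lemma ch_cmp_d X Y Z (g : chmap Y Z) (f : chmap X Y) i j (x : X i) :
  (g j \o f j) (cd X i j x) = cd Z i j ((g i \o f i) x).
Proof. by rewrite /= !cm_d. Qed.

Definition ch_cmp X Y Z (g : chmap Y Z) (f : chmap X Y) : chmap X Z :=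
  @ChMap R X Z (fun i => g i \o f i) (ch_cmp_d g f).

Lemma homotopic_cmp X Y Z (g g' : chmap Y Z) (f f' : chmap X Y) :
  homotopic g g' -> homotopic f f' -> homotopic (ch_cmp g f) (ch_cmp g' f').
Proof.
move=> [h hP] [k kP]; apply: (@homotopic_trans _ _ _ (ch_cmp g f')).
  exists (fun i j => g j \o k i j) => p i q pi iq x /=.
  by rewrite -raddfB (kP p i q) // raddfD /= cm_d.
exists (fun i j => h i j \o f' i) => p i q pi iq x /=.
by rewrite (hP p i q) //= cm_d.
Qed.

Definition signl (b : bool) (M N : lmodType R) (f : {linear M -> N})
  : {linear M -> N} := if b then (\- f : {linear M -> N}) else f.

Lemma signlE b (M N : lmodType R) (f : {linear M -> N}) x :
  signl b f x = (-1) ^+ b *: f x.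
Proof. by case: b; rewrite /= ?expr1 ?expr0 ?scaleN1r ?scale1r. Qed.

Section Shift.
Variables (n : int) (X : cpx R).

(* [X[n]] has [X (i + n)] in degree [i] and differential [(-1)^n d]. *)
Definition sh_d i j : {linear X (i + n) -> X (j + n)} :=
  signl (odd `|n|%N) (cd X (i + n) (j + n)).

Lemma sh_shape i j : i + 1 <> j -> forall x, sh_d i j x = 0.
Proof.
move=> ij x; rewrite signlE cd_shape ?scaler0 // => e; apply: ij.
by apply: (addIr n); rewrite -e addrAC.
Qed.

Lemma sh_sq i j k x : sh_d j k (sh_d i j x) = 0.
Proof. by rewrite !signlE linearZ_LR /= cd_sq !scaler0. Qed.

Lemma sh_bnd :
  exists N : nat, forall i : int, (N < `|i|)%N -> forall x : X (i + n), x = 0.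
Proof.
have [N NP] := cbnd X; exists (N + `|n|)%N => i Ni x; apply: NP.
by lia.
Qed.

Definition sh_cpx : cpx R := Cpx sh_shape sh_sq sh_bnd.

End Shift.

Lemma sh_map_d n X Y (f : chmap X Y) i j (x : sh_cpx n X i) :
  f (j + n) (cd (sh_cpx n X) i j x) = cd (sh_cpx n Y) i j (f (i + n) x).
Proof. by rewrite /= /sh_d !signlE linearZ_LR /= cm_d. Qed.

Definition sh_map n X Y (f : chmap X Y) : chmap (sh_cpx n X) (sh_cpx n Y) :=
  @ChMap R (sh_cpx n X) (sh_cpx n Y) (fun i => f (i + n)) (sh_map_d f).

Lemma homotopic_sh n X Y (f g : chmap X Y) :
  homotopic f g -> homotopic (sh_map n f) (sh_map n g).
Proof.
case=> h hP; exists (fun i j => signl (odd `|n|%N) (h (i + n) (j + n))).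
move=> p i q pi iq x; rewrite /= /sh_d (hP (p + n) _ (q + n)).
- rewrite !signlE !linearZ_LR /= !scalerA -!expr2 -exprM mulnC exprM.
  by rewrite sqrrN expr1n expr1n !scale1r.
- by rewrite addrAC pi.
- by rewrite addrAC iq.
Qed.

Definition Kb_cat : shcat :=
  @ShCat (cpx R) (@chmap R) homotopic ch_id ch_cmp sh_cpx sh_map
    homotopic_refl homotopic_sym homotopic_trans homotopic_cmp
    (fun X Y Z W h g f => homotopic_refl _)
    (fun X Y f => homotopic_eq (fun i x => erefl))
    (fun X Y f => homotopic_eq (fun i x => erefl))
    homotopic_sh
    (fun n X => homotopic_eq (fun i x => erefl))
    (fun n X Y Z g f => homotopic_eq (fun i x => erefl)).

(* The transport from degree [i] to degree [j] if [i = j], and zero otherwise. *)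
Definition tr (M : int -> fgmod R) (i j : int) : {linear M i -> M j} :=
  match i =P j with
  | ReflectT e => match e in _ = j0 return {linear M i -> M j0} with
                  | erefl => idfun
                  end
  | ReflectF _ => \0
  end.

Lemma tr_id M i x : tr M i i x = x.
Proof. by rewrite /tr; case: eqP => // e; rewrite (eq_axiomK e). Qed.

Lemma tr_ne M i j x : i <> j -> tr M i j x = 0.
Proof. by rewrite /tr; case: eqP. Qed.

Section Cone.
Variables (X Y : cpx R) (f : chmap X Y).

Definition cone_ob (i : int) : fgmod R := fg_prod (X (i + 1)) (Y i).

Definition cone_fun i j (z : cone_ob i) : cone_ob j :=
  (- cd X (i + 1) (j + 1) z.1, tr Y (i + 1) j (f (i + 1) z.1) + cd Y i j z.2).

Lemma cone_fun_linear i j : linear (@cone_fun i j).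
Proof.
move=> a u v; rewrite /cone_fun /= !linearP /=; congr pair.
by rewrite /= scalerDr addrACA.
Qed.

HB.instance Definition _ i j :=
  GRing.isLinear.Build R (cone_ob i) (cone_ob j) *:%R (@cone_fun i j)
    (@cone_fun_linear i j).

Definition cone_d i j : {linear cone_ob i -> cone_ob j} := @cone_fun i j.

Lemma cone_shape i j : i + 1 <> j -> forall z, cone_d i j z = 0.
Proof.
move=> ij z; rewrite /= /cone_fun tr_ne // !cd_shape //.
  by rewrite oppr0 addr0.
by move/addIr.
Qed.

Lemma cone_sq i j k z : cone_d j k (cone_d i j z) = 0.
Proof.
rewrite /= /cone_fun /= !raddfN /= cd_sq; congr pair; first by rewrite !oppr0.
rewrite raddfD /= cd_sq addr0.
have [<-|/eqP ij] := eqVneq (i + 1) j; last first.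
  rewrite (tr_ne _ ij) (@cd_shape _ X (i + 1) (j + 1)) ?raddf0 ?oppr0 ?addr0 //.
  by move=> /addIr.
rewrite tr_id -cm_d.
have [<-|/eqP jk] := eqVneq (i + 1 + 1) k; first by rewrite tr_id addNr.
by rewrite (tr_ne _ jk) (@cd_shape _ X _ k) // !raddf0 addr0.
Qed.

Lemma cone_bnd :
  exists N : nat, forall i : int, (N < `|i|)%N -> forall z : cone_ob i, z = 0.
Proof.
have [N NP] := sh_bnd 1 X; have [N' N'P] := cbnd Y.
exists (maxn N N') => i; rewrite gtn_max => /andP[Ni N'i] [x y].
by rewrite (NP i Ni x) (N'P i N'i y).
Qed.

Definition cone : cpx R := Cpx cone_shape cone_sq cone_bnd.

Definition cone_in_fun i (y : Y i) : cone i := (0, y).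

Lemma cone_in_linear i : linear (@cone_in_fun i).
Proof. by move=> a u v; congr pair; rewrite /= scaler0 addr0. Qed.

HB.instance Definition _ i :=
  GRing.isLinear.Build R (Y i) (cone i) *:%R (@cone_in_fun i)
    (@cone_in_linear i).

Lemma cone_in_d i j y :
  cone_in_fun (cd Y i j y) = cd cone i j (cone_in_fun y).
Proof. by rewrite /= /cone_fun /= !raddf0 add0r. Qed.

Definition cone_inj : chmap Y cone :=
  @ChMap R Y cone (fun i => @cone_in_fun i) cone_in_d.

Lemma cone_proj_d i j (z : cone i) :
  (cd cone i j z).1 = cd (sh_cpx 1 X) i j z.1.
Proof. by []. Qed.

Definition cone_proj : chmap cone (sh_cpx 1 X) :=
  @ChMap R cone (sh_cpx 1 X) (fun i => fst) cone_proj_d.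

End Cone.

Inductive cone_tri : tri_class Kb_cat :=
| ConeTri (X Y : Kb_cat) (f : hom X Y) :
    @cone_tri X Y (cone f) f (cone_inj f) (cone_proj f).

Section ConeShift.
Variables (n : int) (X Y : cpx R) (f : chmap X Y).
Let b := odd `|n|%N.
Let C1 := cone (sh_map n f).
Let C2 := sh_cpx n (cone f).

Definition cs_fun i (z : C1 i) : C2 i :=
  (signl b (tr X (i + 1 + n) (i + n + 1)) z.1, z.2).
Definition cs_inv i (z : C2 i) : C1 i :=
  (signl b (tr X (i + n + 1) (i + 1 + n)) z.1, z.2).

Lemma cs_fun_linear i : linear (@cs_fun i).
Proof. by move=> a u v; rewrite /cs_fun /= linearP. Qed.
Lemma cs_inv_linear i : linear (@cs_inv i).
Proof. by move=> a u v; rewrite /cs_inv /= linearP. Qed.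

HB.instance Definition _ i :=
  GRing.isLinear.Build R (C1 i) (C2 i) *:%R (@cs_fun i) (@cs_fun_linear i).
HB.instance Definition _ i :=
  GRing.isLinear.Build R (C2 i) (C1 i) *:%R (@cs_inv i) (@cs_inv_linear i).

Lemma tr_d (W : cpx R) i i' j j' (x : W i) : i = i' -> j = j' ->
  tr W j j' (cd W i j x) = cd W i' j' (tr W i i' x).
Proof. by move=> <- <-; rewrite !tr_id. Qed.

Lemma tr_f i i' (x : X i) : f i' (tr X i i' x) = tr Y i i' (f i x).
Proof.
by have [<-|/eqP ne] := eqVneq i i'; rewrite ?tr_id // !tr_ne // raddf0.
Qed.

Lemma tr_tr (W : int -> fgmod R) i j k (x : W i) : i = j ->
  tr W j k (tr W i j x) = tr W i k x.
Proof. by move=> <-; rewrite tr_id. Qed.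

Lemma tr_sh (W : cpx R) i j (x : W (i + n)) :
  tr (fun k => W (k + n)) i j x = tr W (i + n) (j + n) x.
Proof.
have [<-|/eqP ne] := eqVneq i j; first by rewrite !tr_id.
by rewrite !tr_ne // => /addIr.
Qed.

Lemma sgK (M : lmodType R) (x : M) : (-1) ^+ b *: ((-1) ^+ b *: x) = x.
Proof. by rewrite scalerA -expr2 sqrr_sign scale1r. Qed.

Lemma cs_fun_d i j z : cs_fun (cd C1 i j z) = cd C2 i j (cs_fun z).
Proof.
case: z => x y; rewrite /= /sh_d signlE /= /cone_fun /cs_fun /= !signlE.
congr pair => /=.
  rewrite !linearN /= !linearZ_LR /= -/b -(@tr_d X (i + 1 + n) _ (j + 1 + n)).
  - by rewrite scalerN.
  - by rewrite addrAC.
  - by rewrite addrAC.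
rewrite scalerDr !linearZ_LR /= -/b sgK tr_sh tr_f.
rewrite tr_tr; first reflexivity.
by rewrite addrAC.
Qed.

Lemma cs_K i : cancel (@cs_fun i) (@cs_inv i).
Proof.
case=> x y; rewrite /cs_inv /cs_fun /= !signlE linearZ_LR /= sgK.
by rewrite tr_tr ?tr_id // addrAC.
Qed.

Lemma cs_VK i : cancel (@cs_inv i) (@cs_fun i).
Proof.
case=> x y; rewrite /cs_inv /cs_fun /= !signlE linearZ_LR /= sgK.
by rewrite tr_tr ?tr_id // addrAC.
Qed.

Lemma cs_inv_d i j z : cs_inv (cd C2 i j z) = cd C1 i j (cs_inv z).
Proof.
apply: (can_inj (@cs_K j)).
have := cs_fun_d j (cs_inv z); rewrite (cs_VK z) => ->.
exact: (cs_VK (cd C2 i j z)).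
Qed.

Definition cs_map : chmap C1 C2 := @ChMap R C1 C2 (fun i => @cs_fun i) cs_fun_d.
Definition cs_map_inv : chmap C2 C1 :=
  @ChMap R C2 C1 (fun i => @cs_inv i) cs_inv_d.

Lemma cone_tri_shift :
  exists h', tri_closure cone_tri (shm n (f : @hom Kb_cat X Y))
    (shm n (cone_inj f : @hom Kb_cat Y (cone f))) h'.
Proof.
exists (ch_cmp (cone_proj (sh_map n f)) cs_map_inv).
exists (sh_cpx n X), (sh_cpx n Y), C1, (sh_map n f), (cone_inj (sh_map n f)),
  (cone_proj (sh_map n f)); split; first exact: ConeTri.
exists (@idm Kb_cat _), (@idm Kb_cat _), (cs_map : @hom Kb_cat C1 C2).
split.
  split; try exact: is_iso_idm.
  exists cs_map_inv; split; apply: homotopic_eq => i z; [exact: cs_K|exact: cs_VK].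
split; apply: homotopic_eq => i z //=.
  by rewrite /cs_fun /cone_in_fun /= raddf0.
exact: (congr1 fst (esym (cs_K z))).
Qed.

End ConeShift.

Lemma Kb_dist_shift n (X Y Z : Kb_cat) (f : hom X Y) (g : hom Y Z)
    (h : hom Z (sh 1 X)) :
  tri_closure cone_tri f g h ->
  exists h', tri_closure cone_tri (shm n f) (shm n g) h'.
Proof.
apply: tri_closure_shift => {f g h}X' Y' Z' f g h [{}X {}Y f0].
exact: cone_tri_shift.
Qed.

Definition Kb : tricat := TriCat Kb_dist_shift.

Definition acyclic (X : Kb) : Prop :=
  forall i j k : int, i + 1 = j -> j + 1 = k ->
    exact_at (cd (X : cpx R) i j) (cd (X : cpx R) j k).

Lemma acyclic_sh n (X : Kb) : acyclic X -> acyclic (sh n X).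
Proof.
move=> aX i j k ij jk y.
have ijn : i + n + 1 = j + n by rewrite -ij addrAC.
have jkn : j + n + 1 = k + n by rewrite -jk addrAC.
have E := aX _ _ _ ijn jkn.
rewrite /= /sh_d signlE; split=> [e|[x <-]].
  have /E[x xy] : cd (X : cpx R) (j + n) (k + n) y = 0.
    by rewrite -[LHS](sgK n) e scaler0.
  by exists ((-1) ^+ odd `|n|%N *: x); rewrite signlE linearZ_LR /= sgK.
by rewrite signlE linearZ_LR /= cd_sq !scaler0.
Qed.

Definition Db : tricat := verdier acyclic_sh.

(* The essential image of K^b(proj R) in D^b(mod R). *)
Definition perfect (X : Db) : Prop :=
  exists P : cpx R, (forall i, projective (P i)) /\ @isomorphic Db X P.

Lemma perfect_sh n (X : Db) : perfect X -> perfect (sh n X).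
Proof.
case=> P [Pp XP]; exists (sh_cpx n P); split=> [i|]; first exact: Pp.
exact: (@isomorphic_shm Db n X P XP).
Qed.

Definition Dsg : tricat := verdier perfect_sh.

End Complexes.

(* Main.v *)
From HB Require Import structures.
From mathcomp Require Import all_boot all_order all_algebra.
From mathcomp Require Import boolp zify.
From Corelib Require Import Setoid Morphisms.
Require Import Defs.
Set Implicit Arguments. Unset Strict Implicit. Unset Printing Implicit Defensive.
Import GRing.Theory.
Local Open Scope ring_scope.

(** Suppose that [L] is an (m,n)-Igusa-Todorov algebra with test module [V].  The
    claim is that the stalk complex of [V] generates [Dsg L] in [m + 1] steps.

    In the singularity category complexes of projectives vanish, so an injective
    chain map whose cokernel is such a complex becomes invertible
    ([ses_proj_coker]); in particular attaching projectives to a complex does not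
    change it ([cone_from_proj]).  This reduces every bounded complex [X] to a single
    module: attach a projective to the top degree so that
    the last differential becomes onto, replace the complex by the quasi-isomorphic
    truncation that ends one degree lower, and repeat until only one degree is left
    ([lower_top], [reduce_stalk]).  For the same reason a module is isomorphic, up
    to a shift, to each of its syzygies ([stalk_syzygy]).  Hence [X] is isomorphic
    to a shift of some n-th syzygy, and the exact sequence given by the
    Igusa-Todorov property replaces that syzygy by a complex with terms in [add V]
    in [m + 1] consecutive degrees ([res_stalk]).  Peeling off the terms one by one,
    starting at the bottom degree, puts this complex into the layer [m + 1]
    ([brutal_gen]).

    Two points need work.  The kernels that occur above must be finitely
    generated; this is where the Artin hypothesis enters, through Akizuki's theorem
    that an Artinian commutative ring is Noetherian ([ideal_fg],
    [artin_noetherian]).  Moreover the layers are defined by coproducts in [Dsg L],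
    which is a localization of a localization whose morphisms are formal zigzags.
    Coproducts survive such a localization ([loc_coprod2]) because adding a fixed
    object preserves distinguished triangles, hence extends to zigzags; this last
    property is itself inherited by the localization ([loc_sum_closed]), so the
    argument applies twice, from [Kb] to [Db] and from [Db] to [Dsg]. *)

(** * Rewriting with equality of morphisms *)

#[local] Instance heq_equiv (C : shcat) (X Y : C) : Equivalence (@heq C X Y).
Proof.
by split=> [f|f g|f g h]; [exact: heq_refl|exact: heq_sym|exact: heq_trans].
Qed.
#[local] Instance cmp_proper (C : shcat) (X Y Z : C) :
  Proper (@heq C Y Z ==> @heq C X Y ==> @heq C X Z) (@cmp C X Y Z).
Proof. by move=> g g' hg f f' hf; apply: cmp_heq. Qed.
#[local] Instance shm_proper (C : shcat) n (X Y : C) :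
  Proper (@heq C X Y ==> @heq C (sh n X) (sh n Y)) (@shm C n X Y).
Proof. by move=> f f'; apply: shm_heq. Qed.
#[local] Hint Resolve heq_refl : core.
Local Notation "f ~ g" := (heq f g) (at level 70).
Local Notation "f 'oo' g" := (cmp f g) (at level 40, left associativity).

(** * Isomorphisms, coproducts and triangles *)

Section Category.
Variable C : shcat.
Implicit Types X Y Z S W : C.

Lemma isomorphic_refl X : isomorphic X X.
Proof. by exists (idm X); apply: is_iso_idm. Qed.

Lemma is_iso_inv X Y (f : hom X Y) g : mutual_inv f g -> is_iso g.
Proof. by case=> gf fg; exists f; split. Qed.

Lemma isomorphic_sym X Y : isomorphic X Y -> isomorphic Y X.
Proof. by case=> f [g fg]; exists g; apply: is_iso_inv fg. Qed.

Lemma isomorphic_trans X Y Z : isomorphic X Y -> isomorphic Y Z -> isomorphic X Z.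
Proof. by case=> f fi [g gi]; exists (g oo f); apply: is_iso_cmp. Qed.

Lemma coprod2_ext X Y S (i : hom X S) (j : hom Y S) : is_coprod2 i j ->
  forall Z (v w : hom S Z), v oo i ~ w oo i -> v oo j ~ w oo j -> v ~ w.
Proof.
move=> ij Z v w vi vj; have [u [_ _ uP]] := ij Z (w oo i) (w oo j).
by rewrite (uP v vi vj) -(uP w).
Qed.

Lemma coprod2_sym X Y S (i : hom X S) (j : hom Y S) :
  is_coprod2 i j -> is_coprod2 j i.
Proof.
move=> ij Z f g; have [u [ui uj uP]] := ij Z g f.
by exists u; split=> // v vj vi; apply: uP.
Qed.

Lemma coprod2_iso X Y S X' Y' S' (i : hom X S) (j : hom Y S)
    (a : hom X' X) (b : hom Y' Y) (e : hom S S') :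
  is_coprod2 i j -> is_iso a -> is_iso b -> is_iso e ->
  is_coprod2 (e oo i oo a) (e oo j oo b).
Proof.
move=> ij [a' [a'a aa']] [b' [b'b bb']] [e' [e'e ee']] Z f g.
have [u [ui uj uP]] := ij Z (f oo a') (g oo b').
exists (u oo e'); split.
- by rewrite -!cmpA (cmpA e') e'e cmp1l cmpA ui -cmpA a'a cmp1r.
- by rewrite -!cmpA (cmpA e') e'e cmp1l cmpA uj -cmpA b'b cmp1r.
move=> v vi vj; rewrite -[v]cmp1r -ee' cmpA; apply: cmp_heq => //.
by apply: uP; rewrite -?vi -?vj -!cmpA ?aa' ?bb' !cmp1r.
Qed.

Lemma coprod2_map_iso X Y S X' Y' S' (i : hom X S) (j : hom Y S)
    (i' : hom X' S') (j' : hom Y' S') (a : hom X X') (b : hom Y Y') :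
  is_coprod2 i j -> is_coprod2 i' j' -> is_iso a -> is_iso b ->
  exists e : hom S S', [/\ is_iso e, e oo i ~ i' oo a & e oo j ~ j' oo b].
Proof.
move=> ij ij' [a' [a'a aa']] [b' [b'b bb']].
have [e [ei ej _]] := ij _ (i' oo a) (j' oo b).
have [e' [ei' ej' _]] := ij' _ (i oo a') (j oo b').
exists e; split=> //; exists e'; split.
  apply: (coprod2_ext ij).
    by rewrite -cmpA ei cmpA ei' -cmpA a'a cmp1l cmp1r.
  by rewrite -cmpA ej cmpA ej' -cmpA b'b cmp1l cmp1r.
apply: (coprod2_ext ij').
  by rewrite -cmpA ei' cmpA ei -cmpA aa' cmp1l cmp1r.
by rewrite -cmpA ej' cmpA ej -cmpA bb' cmp1l cmp1r.
Qed.

Definition initial (Z0 : C) (e : forall X, hom Z0 X) : Prop :=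
  forall X (f : hom Z0 X), f ~ e X.

Lemma coprod2_initial Z0 (e : forall X, hom Z0 X) X : initial e ->
  is_coprod2 (idm X) (e X).
Proof.
move=> e0 Z f g; exists f; split=> [||v <- _]; rewrite ?cmp1r //.
by rewrite (e0 _ g); apply: e0.
Qed.

(** Coproducts of finite families are built by adding one object at a time; this
    is how binary coproducts in a localization give all the finite ones. *)
Lemma coprodS r (X : 'I_r.+1 -> C) S' S (i : forall a, hom (X (lift ord0 a)) S')
    (j : hom (X ord0) S) (k : hom S' S) (l : forall a, hom (X a) S) :
  is_coprod i -> is_coprod2 j k -> l ord0 ~ j ->
  (forall a, l (lift ord0 a) ~ k oo i a) -> is_coprod l.
Proof.
move=> iP jkP l0 lS Z f.
have [u' [u'i u'P]] := iP Z (fun a => f (lift ord0 a)).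
have [u [uj uk uP]] := jkP Z (f ord0) u'.
exists u; split=> [a|v vl].
  by case: (unliftP ord0 a) => [b ->|->]; rewrite ?lS ?l0 // cmpA uk.
apply: uP; first by rewrite -l0.
by apply: u'P => a; rewrite -cmpA -lS.
Qed.

Lemma coprod_iso r (X X' : 'I_r -> C) S (i : forall a, hom (X a) S)
    (e : forall a, hom (X' a) (X a)) : is_coprod i -> (forall a, is_iso (e a)) ->
  is_coprod (fun a => i a oo e a).
Proof.
move=> iP eP Z f.
have [u [ui uP]] := iP Z (fun a => f a oo projT1 (cid (eP a))).
exists u; split=> [a|v vi].
  by rewrite cmpA ui -cmpA; case: cid => e' /= [-> _]; rewrite cmp1r.
by apply: uP => a; rewrite -vi -!cmpA; case: cid => e' /= [_ ->]; rewrite cmp1r.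
Qed.

Lemma coprod1 (X : 'I_1 -> C) S (i : forall a, hom (X a) S) :
  is_iso (i ord0) -> is_coprod i.
Proof.
case=> [k [ki ik]] Z f; exists (f ord0 oo k); split=> [a|v vi].
  by rewrite (ord1 a) -cmpA ki cmp1r.
by rewrite -vi -cmpA ik cmp1r.
Qed.

Variable D : tri_class C.

Lemma tri_closure_base X Y Z (f : hom X Y) (g : hom Y Z) h :
  D f g h -> tri_closure D f g h.
Proof.
move=> Dfgh; exists X, Y, Z, f, g, h; split=> //.
exists (idm X), (idm Y), (idm Z).
split; first by split; apply: is_iso_idm.
by split; rewrite ?shm_id ?cmp1l ?cmp1r.
Qed.

Lemma tri_closure_iso X Y Z (f : hom X Y) (g : hom Y Z) h
    X' Y' Z' (f' : hom X' Y') (g' : hom Y' Z') h' :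
  tri_closure D f g h -> tri_iso f g h f' g' h' -> tri_closure D f' g' h'.
Proof.
case=> [X0 [Y0 [Z0 [f0 [g0 [h0 [D0]]]]]]].
case=> a [b [c [[ai bi ci] [ef eg eh]]]] [a1 [b1 [c1 [[ai1 bi1 ci1] [ef1 eg1 eh1]]]]].
exists X0, Y0, Z0, f0, g0, h0; split=> //.
exists (a1 oo a), (b1 oo b), (c1 oo c); split; first by split; apply: is_iso_cmp.
split; first by rewrite -cmpA ef cmpA ef1 cmpA.
  by rewrite -cmpA eg cmpA eg1 cmpA.
by rewrite shm_cmp -cmpA eh cmpA eh1 cmpA.
Qed.

(** Only the first square has to be given: the other two morphisms of the new
    triangle are defined so that their squares commute. *)
Lemma tri_closure_transport X Y Z (f : hom X Y) (g : hom Y Z) h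
    X' Y' Z' (f' : hom X' Y') (a : hom X X') (b : hom Y Y') (c : hom Z Z') :
  tri_closure D f g h -> is_iso a -> is_iso b -> is_iso c ->
  b oo f ~ f' oo a -> exists g' h', tri_closure D f' (g' : hom Y' Z') h'.
Proof.
move=> Df ai bi ci ef; have [b' [b'b bb']] := bi; have [c' [c'c cc']] := ci.
exists (c oo g oo b'), (shm 1 a oo h oo c').
apply: tri_closure_iso Df _; exists a, b, c; split=> //; split=> //.
  by rewrite -!cmpA b'b cmp1r.
by rewrite -!cmpA c'c cmp1r.
Qed.

(** Adding the identity of [W] to the first morphism of a triangle keeps the third
    object [Z]: the trivial triangle of [W] has a zero cone.  For morphisms with
    cone in a given class this says that the class of morphisms is stable under
    sums with identities, whatever the class of cones. *)
Definition sum_closed (E : tri_class C) : Prop :=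
  forall X Y Z (f : hom X Y) (g : hom Y Z) h, E _ _ _ f g h ->
  forall W S S' (i : hom X S) (j : hom W S) (i' : hom Y S') (j' : hom W S')
    (u : hom S S'), is_coprod2 i j -> is_coprod2 i' j' ->
    u oo i ~ i' oo f -> u oo j ~ j' -> exists g' h', E S S' Z u g' h'.

(** Since coproducts are unique up to isomorphism, one choice of the two sums for
    each triangle of a generating class is enough. *)
Lemma sum_closed_closure :
  (forall X Y Z (f : hom X Y) (g : hom Y Z) h, D f g h -> forall W,
    exists S S' (i : hom X S) (j : hom W S) (i' : hom Y S') (j' : hom W S')
      (u : hom S S'),
    [/\ is_coprod2 i j, is_coprod2 i' j', u oo i ~ i' oo f, u oo j ~ j'
      & exists g' h', tri_closure D u (g' : hom S' Z) h']) ->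
  sum_closed (tri_closure D).
Proof.
move=> DP X Y Z f g h [X0 [Y0 [Z0 [f0 [g0 [h0 [D0]]]]]]].
case=> a [b [c [[ai bi ci] [ef _ _]]]] W S S' i j i' j' u ijP ijP' ui uj.
have [S0 [S0' [i0 [j0 [i0' [j0' [u0]]]]]]] := DP _ _ _ _ _ _ D0 W.
case=> ijP0 ijP0' ui0 uj0 [g1 [h1 D1]].
have [a1 [a1i a1i0 a1j0]] := coprod2_map_iso ijP0 ijP ai (is_iso_idm W).
have [b1 [b1i b1i0 b1j0]] := coprod2_map_iso ijP0' ijP' bi (is_iso_idm W).
apply: (tri_closure_transport D1 a1i b1i ci).
apply: (coprod2_ext ijP0).
  by rewrite -!cmpA ui0 a1i0 cmpA b1i0 -cmpA ef cmpA -ui cmpA.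
by rewrite -!cmpA uj0 a1j0 b1j0 cmpA uj.
Qed.

End Category.

(** * Coproducts in a Verdier quotient *)

Section Localization.
Variables (T : tricat) (N : T -> Prop).
Hypothesis N_sh : forall n X, N X -> N (sh n X).
Let Q : tricat := verdier N_sh.

Definition loc (X Y : T) (f : hom X Y) : @hom Q X Y := Linj N f.

Lemma loc_heq (X Y : T) (f g : hom X Y) : f ~ g -> loc f ~ loc g.
Proof. exact: lheq_inj. Qed.
#[local] Instance loc_proper (X Y : T) :
  Proper (@heq T X Y ==> @heq Q X Y) (@loc X Y).
Proof. by move=> f g; apply: loc_heq. Qed.

Lemma loc_cmp (X Y Z : T) (g : hom Y Z) (f : hom X Y) :
  loc (g oo f) ~ loc g oo loc f.
Proof. exact: lheq_injM. Qed.

Lemma loc_id (X : T) : loc (idm X) = @idm Q X. Proof. by []. Qed.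

Lemma loc_iso (X Y : T) (f : hom X Y) : is_iso f -> is_iso (loc f).
Proof.
case=> g [gf fg]; exists (loc g); split; first by rewrite -loc_cmp gf.
by rewrite -loc_cmp fg.
Qed.

Lemma loc_cone_iso (X Y : T) (f : hom X Y) : cone_in N f -> is_iso (loc f).
Proof.
by move=> hf; exists (Linv hf); split; [exact: lheqVl|exact: lheqVr].
Qed.

Lemma loc_dist (X Y Z : T) (f : hom X Y) (g : hom Y Z) h :
  dist f g h -> @dist Q _ _ _ (loc f) (loc g) (loc h).
Proof. by move=> D; apply: tri_closure_base; apply: ImageTri. Qed.

(** Induction on zigzags in which a formal inverse is known only through its two
    equations, so that naturality statements extend from [T] to [Q] by cancelling
    [loc f]. *)
Lemma loc_ind (P : forall X Y : Q, hom X Y -> Prop) :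
  (forall (X Y : T) (f : hom X Y), P _ _ (loc f)) ->
  (forall (X Y : T) (f : hom X Y) (g : @hom Q Y X), cone_in N f ->
     g oo loc f ~ idm _ -> loc f oo g ~ idm _ -> P _ _ g) ->
  (forall X Y Z (g : hom Y Z) (f : hom X Y), P _ _ g -> P _ _ f ->
     P _ _ (g oo f)) ->
  forall X Y f, P X Y f.
Proof.
move=> P1 P2 P3 X Y; elim=> {X Y}.
- exact: P1.
- by move=> X Y s hs; apply: (P2 _ _ s) => //; [exact: lheqVl|exact: lheqVr].
- by move=> X Y Z g Pg f Pf; apply: P3.
Qed.

(** The maps out of [Z0] form a natural transformation from a constant functor, on
    [T] and therefore on zigzags; at [Z0] itself naturality is uniqueness. *)
Lemma loc_initial (Z0 : T) (e : forall X, hom Z0 X) :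
  initial e -> initial (C := Q) (fun X => loc (e X)).
Proof.
move=> e0 X f.
have nat : forall Y Z (f : @hom Q Y Z), f oo loc (e Y) ~ loc (e Z).
  apply: loc_ind => [Y Z g|Y Z g k _ kg gk|Y Z W g k Pg Pk].
  - by rewrite -loc_cmp; apply: loc_heq; apply: e0.
  - have -> : loc (e Z) ~ loc g oo loc (e Y).
      by rewrite -loc_cmp; apply: loc_heq; symmetry; apply: e0.
    by rewrite cmpA kg cmp1l.
  - by rewrite -cmpA Pk Pg.
have := nat _ _ f.
suff -> : loc (e Z0) ~ idm _ by rewrite cmp1r.
by apply: loc_heq; symmetry; apply: e0.
Qed.

Hypothesis dist_sum : sum_closed (@dist T).

Section SumFunctor.
(* [Fo X] is a coproduct of [X] and the fixed object [W]; leaving the order of the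
   two inclusions open makes the section apply to sums on either side. *)
Variables (W : T) (Fo : T -> T) (fi : forall X, hom X (Fo X))
  (fj : forall X, hom W (Fo X)).
Hypothesis fP : forall X, is_coprod2 (fi X) (fj X).

Definition Fm X Y (f : hom X Y) : hom (Fo X) (Fo Y) :=
  projT1 (cid (@fP X _ (fi Y oo f) (fj Y))).

Lemma Fm_i X Y (f : hom X Y) : Fm f oo fi X ~ fi Y oo f.
Proof. by rewrite /Fm; case: cid => u []. Qed.
Lemma Fm_j X Y (f : hom X Y) : Fm f oo fj X ~ fj Y.
Proof. by rewrite /Fm; case: cid => u []. Qed.

Lemma Fm_heq X Y (f g : hom X Y) : f ~ g -> Fm f ~ Fm g.
Proof.
by move=> fg; apply: (coprod2_ext (@fP X)); rewrite ?Fm_i ?Fm_j ?fg.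
Qed.

Lemma Fm_id X : Fm (idm X) ~ idm (Fo X).
Proof.
by apply: (coprod2_ext (@fP X)); rewrite ?Fm_i ?Fm_j ?cmp1l ?cmp1r.
Qed.

Lemma Fm_cmp X Y Z (g : hom Y Z) (f : hom X Y) : Fm (g oo f) ~ Fm g oo Fm f.
Proof.
apply: (coprod2_ext (@fP X)).
  by rewrite -cmpA !Fm_i (cmpA (Fm g)) Fm_i cmpA.
by rewrite Fm_j -cmpA !Fm_j.
Qed.

Lemma Fm_cone X Y (s : hom X Y) : cone_in N s -> cone_in N (Fm s).
Proof.
case=> Z [g [h [D NZ]]].
have [g' [h' D']] := dist_sum D (@fP X) (@fP Y) (Fm_i s) (Fm_j s).
by exists Z, g', h'.
Qed.

(** The sum functor on zigzags exists because a sum with an identity is again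
    inverted in the localization. *)
Fixpoint lF X Y (f : lhom N X Y) : lhom N (Fo X) (Fo Y) :=
  match f with
  | Linj _ _ f => Linj N (Fm f)
  | Linv _ _ _ hs => Linv (Fm_cone hs)
  | Lcmp _ _ _ g f => Lcmp (lF g) (lF f)
  end.

(** [lF] with the type of a map between hom-sets of [Q], for the rewriting lemmas. *)
Definition qF (X Y : Q) (f : hom X Y) : @hom Q (Fo X) (Fo Y) := lF f.

Lemma qF_heq (X Y : Q) (f g : hom X Y) : f ~ g -> qF f ~ qF g.
Proof.
rewrite /qF; elim=> {X Y f g} /=.
- by move=> *; apply: lheq_refl.
- by move=> *; apply: lheq_sym.
- by move=> X Y f g h _ fg _ gh; apply: lheq_trans fg gh.
- by move=> *; apply: lheq_cmp.
- by move=> *; apply: lheqA.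
- move=> X Y f; apply: lheq_trans (lheq_cmp (lheq_inj N (Fm_id Y)) (lheq_refl _)) _.
  exact: lheq1l.
- move=> X Y f; apply: lheq_trans (lheq_cmp (lheq_refl _) (lheq_inj N (Fm_id X))) _.
  exact: lheq1r.
- by move=> *; apply/lheq_inj/Fm_heq.
- move=> X Y Z g f; apply: lheq_trans (lheq_injM _ _ _).
  exact/lheq_inj/Fm_cmp.
- move=> X Y s hs; apply: lheq_trans (lheqVl _) _.
  by apply/lheq_inj; symmetry; apply: Fm_id.
- move=> X Y s hs; apply: lheq_trans (lheqVr _) _.
  by apply/lheq_inj; symmetry; apply: Fm_id.
Qed.

Lemma qF_loc X Y (f : hom X Y) : qF (loc f) = loc (Fm f). Proof. by []. Qed.
Lemma qF_cmp (X Y Z : Q) (g : hom Y Z) (f : hom X Y) : qF (g oo f) = qF g oo qF f.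
Proof. by []. Qed.

Lemma qF_i (X Y : Q) (f : hom X Y) : qF f oo loc (fi X) ~ loc (fi Y) oo f.
Proof.
move: X Y f; apply: loc_ind => [X Y f|X Y f g _ gf fg|X Y Z g f Pg Pf].
- by rewrite qF_loc -!loc_cmp Fm_i.
- have e : qF g oo loc (Fm f) ~ idm _.
    by rewrite -qF_loc -qF_cmp (qF_heq gf); apply: loc_heq; apply: Fm_id.
  rewrite -[X in X ~ _]cmp1r -fg.
  rewrite -!cmpA (cmpA (loc (fi Y))) -loc_cmp -Fm_i loc_cmp.
  by rewrite -cmpA cmpA e cmp1l.
- by rewrite qF_cmp -cmpA Pf cmpA Pg cmpA.
Qed.

Lemma qF_j (X Y : Q) (f : hom X Y) : qF f oo loc (fj X) ~ loc (fj Y).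
Proof.
move: X Y f; apply: loc_ind => [X Y f|X Y f g _ gf fg|X Y Z g f Pg Pf].
- by rewrite qF_loc -!loc_cmp Fm_j.
- have e : qF g oo loc (Fm f) ~ idm _.
    by rewrite -qF_loc -qF_cmp (qF_heq gf); apply: loc_heq; apply: Fm_id.
  by rewrite -(Fm_j f) loc_cmp cmpA e cmp1l.
- by rewrite qF_cmp -cmpA Pf Pg.
Qed.

End SumFunctor.

Hypothesis cop : forall X Y : T, exists S (i : hom X S) (j : hom Y S),
  is_coprod2 i j.

Lemma cop_data : exists (bp : T -> T -> T) (bi : forall X Y, hom X (bp X Y))
    (bj : forall X Y, hom Y (bp X Y)), forall X Y, is_coprod2 (bi X Y) (bj X Y).
Proof.
pose bp X Y := projT1 (cid (cop X Y)).
have bP X Y := projT2 (cid (cop X Y)).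
pose bi X Y : hom X (bp X Y) := projT1 (cid (bP X Y)).
have bjP X Y := projT2 (cid (bP X Y)).
exists bp, bi, (fun X Y => projT1 (cid (bjP X Y))) => X Y.
exact: projT2 (cid (bjP X Y)).
Qed.

(** A cocone [f, g] is induced by the codiagonal after [f + g], which makes sense
    for zigzags because the sum functors do.  Uniqueness holds because the
    codiagonal is natural, so that every [v] out of [X + Y] equals the codiagonal
    after the sum of its two restrictions.  Both facts are first proved in [T] and
    then carried over zigzag by zigzag, without any calculus of fractions. *)
Theorem loc_coprod2 (X Y S : T) (i : hom X S) (j : hom Y S) :
  is_coprod2 i j -> is_coprod2 (loc i) (loc j).
Proof.
move=> ijP.
have [bp [bi [bj bP]]] := cop_data.
pose bP' X Y := coprod2_sym (bP X Y).
(* [F W] adds [W] on the right, [G W] adds [W] on the left *)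
pose F (W : T) := @qF W (bp^~ W) (bi^~ W) (bj^~ W) (bP^~ W).
pose G (W : T) := @qF W (bp W) (bj W) (bi W) (bP' W).
have Fi W (A B : Q) (f : hom A B) : F W _ _ f oo loc (bi A W) ~ loc (bi B W) oo f.
  exact: (qF_i (bP^~ W)).
have Fj W (A B : Q) (f : hom A B) : F W _ _ f oo loc (bj A W) ~ loc (bj B W).
  exact: (qF_j (bP^~ W)).
have Gi W (A B : Q) (f : hom A B) : G W _ _ f oo loc (bj W A) ~ loc (bj W B) oo f.
  exact: (qF_i (bP' W)).
have Gj W (A B : Q) (f : hom A B) : G W _ _ f oo loc (bi W A) ~ loc (bi W B).
  exact: (qF_j (bP' W)).
pose FT (W A B : T) (f : hom A B) := Fm (bP^~ W) f.
pose GT (W A B : T) (f : hom A B) := Fm (bP' W) f.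
have FTi W (A B : T) (f : hom A B) : FT W _ _ f oo bi A W ~ bi B W oo f.
  exact: (Fm_i (bP^~ W)).
have FTj W (A B : T) (f : hom A B) : FT W _ _ f oo bj A W ~ bj B W.
  exact: (Fm_j (bP^~ W)).
have GTi W (A B : T) (f : hom A B) : GT W _ _ f oo bj W A ~ bj W B oo f.
  exact: (Fm_i (bP' W)).
have GTj W (A B : T) (f : hom A B) : GT W _ _ f oo bi W A ~ bi W B.
  exact: (Fm_j (bP' W)).
have Fcmp W (A B E : Q) (g : hom B E) (f : hom A B) :
  F W _ _ (g oo f) = F W _ _ g oo F W _ _ f by [].
have Gcmp W (A B E : Q) (g : hom B E) (f : hom A B) :
  G W _ _ (g oo f) = G W _ _ g oo G W _ _ f by [].
have Fheq W (A B : Q) (g f : hom A B) : g ~ f -> F W _ _ g ~ F W _ _ f.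
  exact: qF_heq.
have Gheq W (A B : Q) (g f : hom A B) : g ~ f -> G W _ _ g ~ G W _ _ f.
  exact: qF_heq.
have Floc W (A B : T) (f : hom A B) : F W _ _ (loc f) = loc (FT W _ _ f) by [].
have Gloc W (A B : T) (f : hom A B) : G W _ _ (loc f) = loc (GT W _ _ f) by [].
have Fid W A : F W _ _ (@idm Q A) ~ idm _.
  by apply: loc_heq; apply: (Fm_id (bP^~ W)).
have Gid W A : G W _ _ (@idm Q A) ~ idm _.
  by apply: loc_heq; apply: (Fm_id (bP' W)).
(* the two partial functors commute: for two morphisms of [T], for one of them a
   zigzag, for two zigzags *)
have FG0 (A B A' B' : T) (f : hom A B) (g : hom A' B') :
    F B' _ _ (loc f) oo G A _ _ (loc g) ~ G B _ _ (loc g) oo F A' _ _ (loc f).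
  rewrite !Floc !Gloc -!loc_cmp; apply: loc_heq.
  apply: (coprod2_ext (bP _ _)).
    by rewrite -!cmpA GTj !FTi cmpA GTj.
  by rewrite -!cmpA GTi cmpA !FTj GTi.
have FG1 (A B : T) (f : hom A B) (A' B' : Q) (g : hom A' B') :
    F B' _ _ (loc f) oo G A _ _ g ~ G B _ _ g oo F A' _ _ (loc f).
  move: A' B' g; apply: loc_ind => [A' B' g|A' B' g k _ kg gk|A' B' E g k Pg Pk].
  - exact: FG0.
  - have kG W : G W _ _ k oo G W _ _ (loc g) ~ idm _ by rewrite -Gcmp (Gheq _ _ _ _ _ kg).
    have Gk W : G W _ _ (loc g) oo G W _ _ k ~ idm _ by rewrite -Gcmp (Gheq _ _ _ _ _ gk).
    rewrite -[X in X ~ _]cmp1l -(kG B) -!cmpA (cmpA (G B _ _ (loc g))) -FG0.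
    by rewrite -!cmpA Gk cmp1r.
  - by rewrite !Gcmp cmpA Pg -cmpA Pk cmpA.
have FG (A B : Q) (f : hom A B) (A' B' : Q) (g : hom A' B') :
    F B' _ _ f oo G A _ _ g ~ G B _ _ g oo F A' _ _ f.
  move: A B f; apply: loc_ind => [A B f|A B f k _ kf fk|A B E f k Pf Pk].
  - exact: FG1.
  - have kF W : F W _ _ k oo F W _ _ (loc f) ~ idm _ by rewrite -Fcmp (Fheq _ _ _ _ _ kf).
    have Fk W : F W _ _ (loc f) oo F W _ _ k ~ idm _ by rewrite -Fcmp (Fheq _ _ _ _ _ fk).
    rewrite -[X in _ ~ X]cmp1l -(kF B') -!cmpA (cmpA (F B' _ _ (loc f))) FG1.
    by rewrite -!cmpA Fk cmp1r.
  - by rewrite !Fcmp -cmpA Pk !cmpA Pf.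
have nabla (Z : T) : exists n : hom (bp Z Z) Z,
    n oo bi Z Z ~ idm Z /\ n oo bj Z Z ~ idm Z.
  by have [n [n1 n2 _]] := bP Z Z Z (idm Z) (idm Z); exists n.
pose nab Z := projT1 (cid (nabla Z)).
have nabi Z : nab Z oo bi Z Z ~ idm Z by rewrite /nab; case: cid => n [].
have nabj Z : nab Z oo bj Z Z ~ idm Z by rewrite /nab; case: cid => n [].
have nab_natT (A B : T) (v : hom A B) : loc v oo loc (nab A) ~
    loc (nab B) oo (F B _ _ (loc v) oo G A _ _ (loc v)).
  rewrite Floc Gloc -!loc_cmp; apply: loc_heq; apply: (coprod2_ext (bP _ _)).
    by rewrite -!cmpA GTj FTi nabi cmp1r (cmpA (nab B)) nabi cmp1l.
  by rewrite -!cmpA GTi (cmpA (FT _ _ _ _)) FTj nabj cmp1r cmpA nabj cmp1l.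
have nab_nat (A B : Q) (v : hom A B) :
    v oo loc (nab A) ~ loc (nab B) oo (F B _ _ v oo G A _ _ v).
  move: A B v; apply: loc_ind => [A B v|A B v k _ kv vk|A B E v w Pv Pw].
  - exact: nab_natT.
  - have Gk W : G W _ _ (loc v) oo G W _ _ k ~ idm _ by rewrite -Gcmp (Gheq _ _ _ _ _ vk).
    have Fk W : F W _ _ (loc v) oo F W _ _ k ~ idm _ by rewrite -Fcmp (Fheq _ _ _ _ _ vk).
    have e : loc v oo loc (nab A) oo (F A _ _ k oo G B _ _ k) ~ loc (nab B).
      rewrite nab_natT -!cmpA (cmpA (G A _ _ (loc v))) -FG -!cmpA Gk cmp1r Fk.
      by rewrite cmp1r.
    by rewrite -e -!cmpA (cmpA k) kv cmp1l.
  - rewrite -cmpA Pw cmpA Pv Fcmp Gcmp -!cmpA.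
    do 2 apply: cmp_heq => //.
    by rewrite !cmpA -FG.
have bext (X0 Y0 : T) (Z : Q) (v v' : @hom Q (bp X0 Y0) Z) :
    v oo loc (bi X0 Y0) ~ v' oo loc (bi X0 Y0) ->
    v oo loc (bj X0 Y0) ~ v' oo loc (bj X0 Y0) -> v ~ v'.
  move=> vi vj; set s := bp X0 Y0.
  have key (w : @hom Q s Z) : w ~ loc (nab Z) oo
      (F Z _ _ (w oo loc (bi X0 Y0)) oo G X0 _ _ (w oo loc (bj X0 Y0))).
    have e : loc (nab s) oo (F s _ _ (loc (bi X0 Y0)) oo G X0 _ _ (loc (bj X0 Y0))) ~ idm _.
      rewrite Floc Gloc -!loc_cmp -loc_id; apply: loc_heq; apply: (coprod2_ext (bP _ _)).
        by rewrite -!cmpA GTj FTi cmpA nabi cmp1l.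
      by rewrite -!cmpA GTi (cmpA (FT _ _ _ _)) FTj cmpA nabj.
    rewrite -[X in X ~ _]cmp1r -e (cmpA w) nab_nat Fcmp Gcmp -!cmpA.
    by do 2 apply: cmp_heq => //; rewrite !cmpA FG.
  by rewrite (key v) (key v') (Fheq _ _ _ _ _ vi) (Gheq _ _ _ _ _ vj).
have bpP X0 Y0 : is_coprod2 (loc (bi X0 Y0)) (loc (bj X0 Y0)).
  move=> Z f g; pose u := loc (nab Z) oo (F Z _ _ f oo G X0 _ _ g).
  have ui : u oo loc (bi X0 Y0) ~ f.
    by rewrite /u -!cmpA Gj Fi cmpA -loc_cmp nabi cmp1l.
  have uj : u oo loc (bj X0 Y0) ~ g.
    by rewrite /u -!cmpA Gi (cmpA (F _ _ _ _)) Fj cmpA -loc_cmp nabj cmp1l.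
  by exists u; split=> // v vi vj; apply: bext; rewrite ?ui ?uj.
have [e [ei e1 e2]] := coprod2_map_iso (bP X Y) ijP (is_iso_idm X) (is_iso_idm Y).
have := coprod2_iso (bpP X Y) (is_iso_idm (X : Q)) (is_iso_idm (Y : Q)) (loc_iso ei).
have E1 : loc e oo loc (bi X Y) oo @idm Q X ~ loc i by rewrite -!loc_cmp e1 !cmp1r.
have E2 : loc e oo loc (bj X Y) oo @idm Q Y ~ loc j by rewrite -!loc_cmp e2 !cmp1r.
move=> P Z f g; have [u [ui uj uP]] := P Z f g.
exists u; split=> [||v]; rewrite -?E1 -?E2 //; exact: uP.
Qed.

Lemma loc_cop (X Y : Q) : exists S (i : hom X S) (j : hom Y S), is_coprod2 i j.
Proof.
by have [S [i [j /loc_coprod2 ij]]] := cop X Y; exists S, (loc i), (loc j).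
Qed.

Lemma loc_sum_closed : sum_closed (@dist Q).
Proof.
apply: sum_closed_closure => A B E a b c H W.
case: H => {A B E a b c} X Y Z f g h D.
have [S [i [j ij]]] := cop X W; have [S' [i' [j' ij']]] := cop Y W.
have [u [ui uj _]] := ij _ (i' oo f) j'.
have [g1 [h1 D1]] := dist_sum D ij ij' ui uj.
exists S, S', (loc i), (loc j), (loc i'), (loc j'), (loc u).
split; try exact: loc_coprod2.
- by rewrite -loc_cmp ui loc_cmp.
- by rewrite -loc_cmp uj.
by exists (loc g1), (loc h1); apply: loc_dist.
Qed.

End Localization.

(** * Artinian rings are Noetherian *)

Section Span.
Variable R : pzRingType.
Implicit Types M N : lmodType R.

Definition span M (s : seq M) (x : M) : Prop :=
  forall S, is_submod S -> (forall y, y \in s -> S y) -> S x.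

Definition fg_sub M (S : M -> Prop) : Prop :=
  exists s : seq M, forall x, S x <-> span s x.

Lemma span_submod M (s : seq M) : is_submod (span s).
Proof.
split=> [S []//|x y hx hy S hS sS|a x hx S hS sS].
  by case: (hS) => _ SD _; apply: SD; [apply: hx|apply: hy].
by case: (hS) => _ _ SZ; apply: SZ; apply: hx.
Qed.

Lemma mem_span M (s : seq M) x : x \in s -> span s x.
Proof. by move=> xs S _; apply. Qed.

Lemma span_min M (s : seq M) S : is_submod S -> (forall y, y \in s -> S y) ->
  forall x, span s x -> S x.
Proof. by move=> hS sS x; apply. Qed.

Lemma span_sub M (s t : seq M) : {subset s <= t} -> forall x, span s x -> span t x.
Proof.
by move=> st; apply: span_min (span_submod t) _ => y /st; apply: mem_span.
Qed.

Lemma submodN M (S : M -> Prop) x : is_submod S -> S x -> S (- x).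
Proof. by case=> _ _ SZ Sx; rewrite -scaleN1r; apply: SZ. Qed.

Lemma submodB M (S : M -> Prop) x y : is_submod S -> S x -> S y -> S (x - y).
Proof. by move=> hS Sx /(submodN hS) Sy; case: hS => _ SD _; apply: SD. Qed.

Lemma submodD M (S : M -> Prop) x y : is_submod S -> S x -> S y -> S (x + y).
Proof. by case=> _ SD _; apply: SD. Qed.

Lemma submodZ M (S : M -> Prop) a x : is_submod S -> S x -> S (a *: x).
Proof. by case=> _ _ SZ; apply: SZ. Qed.

Lemma submod0 M (S : M -> Prop) : is_submod S -> S 0.
Proof. by case. Qed.

Lemma span0 M (x : M) : span [::] x -> x = 0.
Proof.
apply: (@span_min _ [::] (fun x => x = 0)) => //; split=> // [y z -> ->|a y ->].
  by rewrite addr0.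
by rewrite scaler0.
Qed.

Lemma span_cons M (a : M) s x : span (a :: s) x ->
  exists c y, span s y /\ x = c *: a + y.
Proof.
apply: (@span_min _ (a :: s) (fun x => exists c y, span s y /\ x = c *: a + y)).
  split.
  - by exists 0, 0; split; [exact: submod0 (span_submod s)|rewrite scale0r addr0].
  - move=> y z [c [y' [hy ->]]] [d [z' [hz ->]]]; exists (c + d), (y' + z').
    by split; [exact: submodD (span_submod s) _ _|rewrite scalerDl addrACA].
  - move=> b y [c [y' [hy ->]]]; exists (b * c), (b *: y').
    by split; [exact: submodZ (span_submod s) _|rewrite scalerDr scalerA].
move=> y; rewrite inE => /orP[/eqP ->|ys].
  by exists 1, 0; split; [exact: submod0 (span_submod s)|rewrite scale1r addr0].
by exists 0, y; split; [exact: mem_span|rewrite scale0r add0r].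
Qed.

(** Finite generation of an extension, with a linear relation [r] in the place of
    the quotient map: in the induction on generators below, the coefficient of the
    first generator is not a function of the element. *)
Lemma fg_ext N M (S : M -> Prop) (r : N -> M -> Prop) :
  is_submod S -> r 0 0 ->
  (forall c d x y, r c x -> r d y -> r (c + d) (x + y)) ->
  (forall a c x, r c x -> r (a *: c) (a *: x)) ->
  (forall x, S x -> exists c, r c x) ->
  fg_sub (fun c => exists2 x, S x & r c x) ->
  fg_sub (fun x => S x /\ r 0 x) -> fg_sub S.
Proof.
move=> hS r0 rD rZ Sr [cs csP] [us usP].
have lift (l : seq N) : (forall c, c \in l -> exists2 x, S x & r c x) ->
    exists zs : seq M, (forall z, z \in zs -> S z) /\
      forall c, span l c -> exists2 z, span zs z & r c z.
  elim: l => [|c l IH] lP.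
    exists [::]; split=> // c /span0 ->.
    by exists 0 => //; exact: submod0 (span_submod _).
  have [x Sx rx] := lP c (mem_head _ _).
  have [d dl|zs [Szs zsP]] := IH; first by apply: lP; rewrite inE dl orbT.
  exists (x :: zs); split=> [z|d /span_cons[a [y [/zsP[z hz rz] ->]]]].
    by rewrite inE => /orP[/eqP ->//|/Szs].
  exists (a *: x + z); last by apply: rD => //; apply: rZ.
  apply: submodD (span_submod _) _ _.
    by apply: submodZ (span_submod _) _; apply: mem_span; rewrite mem_head.
  by apply: span_sub hz => w wz; rewrite inE wz orbT.
have [zs [Szs zsP]] := lift cs (fun c hc => proj2 (csP c) (mem_span hc)).
exists (zs ++ us) => x; split=> [Sx|]; last first.
  apply: span_min hS _ _ => y; rewrite mem_cat => /orP[/Szs//|yu].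
  by have [] := proj2 (usP y) (mem_span yu).
have [c rc] := Sr x Sx.
have [z zzs rz] := zsP c (proj1 (csP c) (ex_intro2 _ _ x Sx rc)).
rewrite -(subrK z x); apply: submodD (span_submod _) _ _; last first.
  by apply: span_sub zzs => w wz; rewrite mem_cat wz.
have: span us (x - z).
  apply/usP; split; first by apply: submodB => //; exact: span_min hS Szs _ zzs.
  by have := rD _ _ _ _ rc (rZ (-1) _ _ rz); rewrite !scaleN1r subrr.
by apply: span_sub => w wz; rewrite mem_cat wz orbT.
Qed.

Lemma noeth_span M (hR : forall I : R^o -> Prop, is_submod I -> fg_sub I)
    (g : seq M) (S : M -> Prop) :
  is_submod S -> (forall x, S x -> span g x) -> fg_sub S.
Proof.
elim: g S => [|a g IH] S hS Sg.
  exists [::] => x; split=> [/Sg//|/span0 ->]; exact: submod0.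
have sg := span_submod g.
pose r (c : R^o) x := span g (x - (c : R) *: a).
have r0 : r 0 0 by rewrite /r scale0r subrr; exact: submod0.
have rD c d x y : r c x -> r d y -> r (c + d) (x + y).
  by rewrite /r scalerDl opprD addrACA; apply: submodD.
have rZ b c x : r c x -> r (b *: c) (b *: x).
  by rewrite /r -scalerA -scalerBr; apply: submodZ.
apply: (fg_ext (r := r)) => //.
- move=> x /Sg /span_cons[c [y [hy ->]]]; exists c.
  by rewrite /r addrAC subrr add0r.
- apply: hR; split.
  + by exists 0 => //; exact: submod0.
  + move=> c d [x Sx rx] [y Sy ry]; exists (x + y); last exact: rD.
    exact: submodD.
  + by move=> b c [x Sx rx]; exists (b *: x); [exact: submodZ|exact: rZ].
- apply: IH; last by move=> x [_]; rewrite /r scale0r subr0.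
  split.
  + by split=> //; exact: submod0.
  + move=> x y [Sx rx] [Sy ry]; split; first exact: submodD.
    by rewrite -[0]addr0; apply: rD.
  + move=> b x [Sx rx]; split; first exact: submodZ.
    by have := rZ b _ _ rx; rewrite scaler0.
Qed.

Lemma span_lin M (s : seq M) x : span s x ->
  exists c : 'I_(size s) -> R, x = \sum_i c i *: s`_i.
Proof.
apply: (@span_min _ s (fun x => exists c : 'I_(size s) -> R, x = \sum_i c i *: s`_i)).
  split.
  - by exists (fun=> 0); rewrite big1 // => i _; rewrite scale0r.
  - move=> y z [c ->] [d ->]; exists (fun i => c i + d i).
    by rewrite -big_split; apply: eq_bigr => i _; rewrite scalerDl.
  - move=> b y [c ->]; exists (fun i => b * c i).
    by rewrite scaler_sumr; apply: eq_bigr => i _; rewrite scalerA.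
move=> y ys; have ylt : (index y s < size s)%N by rewrite index_mem.
exists (fun i => (i == Ordinal ylt)%:R).
rewrite (bigD1 (Ordinal ylt)) //= eqxx scale1r nth_index //.
by rewrite big1 ?addr0 // => i /negbTE ->; rewrite scale0r.
Qed.

End Span.

Section Akizuki.
Variable k : comPzRingType.
Hypothesis hk : artinian k.

Lemma submod_ideal (I : k^o -> Prop) : is_submod I -> is_ideal (I : k -> Prop).
Proof. by []. Qed.

(** The minimum condition, from the chain condition by dependent choice. *)
Lemma ex_min_ideal (F : (k^o -> Prop) -> Prop) I0 : is_submod I0 -> F I0 ->
  exists I, [/\ is_submod I, F I & forall J, is_submod J -> F J ->
    (forall x, J x -> I x) -> forall x, I x -> J x].
Proof.
move=> hI0 FI0; apply: contrapT => noI.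
pose G := {I : k^o -> Prop | is_submod I /\ F I}.
have nextP (I : G) : exists J : G,
    (forall x, sval J x -> sval I x) /\ ~ (forall x, sval I x -> sval J x).
  apply: contrapT => noJ; apply: noI; exists (sval I).
  case: (svalP I) => hI FI; split=> // J hJ FJ JI x Ix.
  apply: contrapT => nJx; apply: noJ; exists (exist _ J (conj hJ FJ)).
  by split=> // /(_ x Ix).
pose next I := projT1 (cid (nextP I)).
pose u n := iter n next (exist _ I0 (conj hI0 FI0)).
have [N NP] : exists N, forall n, (N <= n)%N -> forall x, sval (u N) x -> sval (u n) x.
  apply: (hk (I := fun n => sval (u n) : k -> Prop)) => n; first by case: (svalP (u n)).
  by move=> x; rewrite /u /= /next; case: cid => J /= [+ _]; apply.
have := NP N.+1 (leqnSn N).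
by rewrite {2}/u /= /next -/(u N); case: cid => J /= [].
Qed.

(** Akizuki's theorem.  Let [I] be minimal among the ideals that are not finitely
    generated.  If [a I] is not all of [I], then it is finitely generated, and if
    [a] does not kill [I], then so is the annihilator of [a] in [I]; both cannot
    happen.  So every scalar kills [I] or, by the chain condition on its powers,
    acts invertibly on it: [I] is a vector space over a residue field.  An infinite
    independent sequence in it would give a strictly decreasing chain of spans of
    tails, so [I] is finitely generated after all. *)
Theorem ideal_fg (I : k^o -> Prop) : is_submod I -> fg_sub I.
Proof.
move=> hI0; apply: contrapT => nfgI0.
have [{hI0 nfgI0}{}I [hI nfgI minI]] :=
  ex_min_ideal (F := fun I => ~ fg_sub I) hI0 nfgI0.
have fgJ (J : k^o -> Prop) : is_submod J -> (forall x, J x -> I x) ->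
    ~ (forall x, I x -> J x) -> fg_sub J.
  by move=> hJ JI nIJ; apply: contrapT => nfgJ; apply: nIJ; apply: minI.
(* by [fg_ext] for multiplication by [a], as all proper subideals of [I] are
   finitely generated *)
have dich (a : k) : (forall x, I x -> a * x = 0) \/
    (forall y, I y -> exists2 x, I x & y = a * x).
  apply: contrapT => /not_orP[na nb]; apply: nfgI.
  pose r (c x : k^o) := (c : k) = a * (x : k).
  apply: (fg_ext (r := r)) => //.
  - by rewrite /r mulr0.
  - by move=> c d x y; rewrite /r mulrDr => -> ->.
  - by move=> b c x; rewrite /r => ->; rewrite /GRing.scale /= mulrCA.
  - by move=> x _; exists (a * x).
  - apply: fgJ.
    + split; first by exists 0; [exact: submod0|rewrite /r mulr0].
        move=> c d [x Ix ->] [y Iy ->]; exists (x + y); first exact: submodD.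
        by rewrite /r mulrDr.
      move=> b c [x Ix ->]; exists (b *: x); first exact: submodZ.
      by rewrite /r /GRing.scale /= mulrCA.
    + by move=> c [x Ix ->]; apply: (submodZ (a : k) hI Ix).
    + by move=> h; apply: nb => y /h[x Ix]; exists x.
  - apply: fgJ.
    + split; first by split; [exact: submod0|rewrite /r mulr0].
        move=> x y [Ix ex] [Iy ey]; split; first exact: submodD.
        by rewrite /r mulrDr -ex -ey addr0.
      move=> b x [Ix ex]; split; first exact: submodZ.
      by rewrite /r /GRing.scale /= mulrCA -ex mulr0.
    + by move=> x [].
    + by move=> h; apply: na => x /h[_ <-].
(* the ideals generated by the powers of [a] become constant, so [a ^+ N] is
   [c * a ^+ N.+1] for some [c], and multiplication by [a ^+ N] maps [I] onto [I] *)
have inv (a x0 : k) : I x0 -> a * x0 <> 0 ->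
    exists c, forall x, I x -> c * a * x = x.
  move=> Ix0 ax0; case: (dich a) => [a0|aI]; first by case: ax0; apply: a0.
  have aXI n y : I y -> exists2 x, I x & y = a ^+ n * x.
    elim: n y => [|n IH] y Iy; first by exists y; rewrite ?expr0 ?mul1r.
    have [x Ix ->] := IH y Iy; have [z Iz ->] := aI x Ix.
    by exists z; rewrite // mulrA -exprSr.
  have [N NP] : exists N, forall n, (N <= n)%N ->
      forall x : k, (exists c, x = c * a ^+ N) -> (exists c, x = c * a ^+ n).
    apply: (hk (I := fun n x => exists c, x = c * a ^+ n)) => n.
      split; first by exists 0; rewrite mul0r.
        by move=> x y [c ->] [d ->]; exists (c + d); rewrite mulrDl.
      by move=> b x [c ->]; exists (b * c); rewrite mulrA.
    by move=> x [c ->]; exists (c * a); rewrite exprS mulrA.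
  have [|c cP] := NP N.+1 (leqnSn N) (a ^+ N); first by exists 1; rewrite mul1r.
  exists c => x /(aXI N)[y Iy ->].
  by rewrite [in RHS]cP exprS !mulrA.
have nextP (s : seq k^o) : (forall y, y \in s -> I y) ->
    exists x, I x /\ ~ span s x.
  move=> sI; apply: contrapT => nx; apply: nfgI; exists s => x; split=> [Ix|].
    by apply: contrapT => nsx; apply: nx; exists x.
  exact: span_min.
(* [x n] lies outside the span of the earlier terms, and [J n] is the span of the
   tail from [n] on *)
pose H := {s : seq k^o | forall y, y \in s -> I y}.
pose nx (s : H) := projT1 (cid (nextP (sval s) (svalP s))).
have nxI (s : H) : I (nx s) by rewrite /nx; case: cid => x [].
have nxN (s : H) : ~ span (sval s) (nx s) by rewrite /nx; case: cid => x [].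
have addP (s : H) y : y \in nx s :: sval s -> I y.
  by rewrite inE => /orP[/eqP ->//|/(svalP s)].
have nilP (y : k^o) : y \in [::] -> I y by [].
pose u n := iter n (fun s => exist _ _ (@addP s) : H) (exist _ [::] nilP : H).
pose x n := nx (u n).
have xu i n : (i < n)%N -> x i \in sval (u n).
  elim: n => // n IH; rewrite ltnS leq_eqVlt => /orP[/eqP ->|/IH h]; rewrite /= inE.
    by rewrite eqxx.
  by rewrite h orbT.
pose J n := fun y : k^o => exists m, span [seq x i | i <- iota n m] y.
have Jmon n m m' y : (m <= m')%N -> span [seq x i | i <- iota n m] y ->
    span [seq x i | i <- iota n m'] y.
  move=> mm'; apply: span_sub => _ /mapP[i hi ->]; apply: map_f.
  by move: hi; rewrite !mem_iota; lia.
have hJ n : is_submod (J n).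
  split; first by exists 0%N; exact: submod0 (span_submod _).
    move=> y z [m hy] [m' hz]; exists (m + m')%N.
    apply: submodD (span_submod _) _ _; first by apply: Jmon hy; lia.
    by apply: Jmon hz; lia.
  by move=> b y [m hy]; exists m; apply: submodZ (span_submod _) _.
have [N NP] : exists N, forall n, (N <= n)%N -> forall y, J N y -> J n y.
  apply: (hk (I := J)) => [n|n y [m hy]]; first exact: submod_ideal.
  exists m.+1; apply: span_sub hy => _ /mapP[i hi ->]; apply: map_f.
  by move: hi; rewrite !mem_iota; lia.
have [|m] := NP N.+1 (leqnSn N) (x N).
  by exists 1%N; apply: mem_span; rewrite /= inE.
(* [x N] is a combination of later terms; removing zero coefficients at the end,
   the last term used becomes a combination of earlier ones *)
elim: m => [/span0 xN0|m IH].
  by apply: (nxN (u N)); rewrite -/(x N) xN0; exact: submod0 (span_submod _).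
rewrite -[m.+1]addn1 iotaD map_cat /= => hx.
have {hx} : span (x (N.+1 + m)%N :: [seq x i | i <- iota N.+1 m]) (x N).
  by apply: span_sub hx => z; rewrite mem_cat !inE orbC.
move=> /span_cons[c [y [hy e]]].
have [c0|/eqP c0] := eqVneq (c * x (N.+1 + m)%N) 0.
  by apply: IH; rewrite e /GRing.scale /= c0 add0r.
have [c' c'P] := inv c (x (N.+1 + m)%N) (nxI _) c0.
apply: (nxN (u (N.+1 + m)%N)); rewrite -/(x (N.+1 + m)%N).
have -> : x (N.+1 + m)%N = (c' : k) *: (x N - y).
  by rewrite e addrK scalerA /GRing.scale /= c'P //; apply: nxI.
have hs := span_submod (sval (u (N.+1 + m)%N)).
apply: (submodZ _ hs); apply: (submodB hs).
  by apply: mem_span; apply: xu; lia.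
apply: span_sub hy => _ /mapP[i hi ->]; apply: xu.
by move: hi; rewrite mem_iota; lia.
Qed.

End Akizuki.

Section ArtinAlgebra.
Variables (k : comPzRingType) (L : algType k).

(** Restriction of scalars; an alias, so that the two module structures on one
    carrier do not compete. *)
Definition restr (M : lmodType L) : Type := M.
HB.instance Definition _ M := GRing.Zmodule.on (restr M).
Definition restr_scale M (a : k) (x : restr M) : restr M := (a%:A : L) *: (x : M).
Lemma restr_scaleA M a b (x : restr M) :
  restr_scale a (restr_scale b x) = restr_scale (a * b) x.
Proof. by rewrite /restr_scale scalerA -scalerAl mul1r scalerA. Qed.
Lemma restr_scale1 M : left_id 1 (@restr_scale M).
Proof. by move=> x; rewrite /restr_scale !scale1r. Qed.
Lemma restr_scaleDr M : right_distributive (@restr_scale M) +%R.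
Proof. by move=> a x y; rewrite /restr_scale scalerDr. Qed.
Lemma restr_scaleDl M (x : restr M) : {morph (@restr_scale M)^~ x : a b / a + b}.
Proof. by move=> a b; rewrite /restr_scale !scalerDl. Qed.
HB.instance Definition _ M := GRing.Zmodule_isLmodule.Build k (restr M)
  (@restr_scaleA M) (@restr_scale1 M) (@restr_scaleDr M) (@restr_scaleDl M).

Lemma artin_noetherian : artin_algebra L ->
  forall (M : fgmod L) (S : M -> Prop), is_submod S ->
  exists n (g : 'I_n -> M), (forall i, S (g i)) /\
    forall x, S x -> exists c : 'I_n -> L, x = \sum_i c i *: g i.
Proof.
case=> hk [m [l lP]] [M [n [g gP]]] S hS /=.
have hSk : is_submod (S : restr M -> Prop).
  by case: hS => S0 SD SZ; split=> // a x; apply: SZ.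
pose lg : seq (restr M) := [seq l i *: g j | i <- enum 'I_m, j <- enum 'I_n].
have [s sP] : fg_sub (S : restr M -> Prop).
  apply: (noeth_span (ideal_fg hk) (g := lg) hSk) => x _.
  have hlg := span_submod lg.
  have [c ->] := gP x; elim/big_ind: _ => [|y z|j _].
  - exact: submod0 hlg.
  - exact: submodD hlg.
  have [d ->] := lP (c j); rewrite scaler_suml; elim/big_ind: _ => [|y z|i _].
  - exact: submod0 hlg.
  - exact: submodD hlg.
  have -> : (d i *: l i) *: g j = (d i)%:A *: (l i *: g j).
    by rewrite scalerA -scalerAl mul1r.
  apply: (submodZ (M := restr M) (d i) hlg).
  apply: mem_span; apply: allpairs_f; exact: mem_enum.
exists (size s), (fun i => s`_i); split=> [i|x /sP].
  by apply/sP; apply: mem_span; apply: mem_nth.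
move=> /span_lin[c ->]; exists (fun i => (c i)%:A).
by [].
Qed.

End ArtinAlgebra.

(** * Quasi-isomorphisms and short exact sequences *)

Section QuasiIsomorphisms.
Variable R : pzRingType.
Implicit Types X Y Z A B : cpx R.

Definition quasi_iso X Y (f : chmap X Y) : Prop := acyclic (cone f : Kb R).

Lemma acyclicP X : (forall i (y : X (i + 1)), cd X (i + 1) (i + 1 + 1) y = 0 ->
    exists x, cd X i (i + 1) x = y) -> acyclic (X : Kb R).
Proof.
move=> aX i _ _ <- <- y; split; first exact: aX.
by case=> x <-; apply: cd_sq.
Qed.

Lemma quasi_isoP X Y (f : chmap X Y) :
  (forall i (a : X (i + 1 + 1)) (b : Y (i + 1)),
    cd X _ (i + 1 + 1 + 1) a = 0 -> f _ a + cd Y _ _ b = 0 ->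
    exists a' b', - cd X (i + 1) _ a' = a /\ f _ a' + cd Y i _ b' = b) ->
  quasi_iso f.
Proof.
move=> fP; apply: acyclicP => i [a b] /= [ea eb].
have da : cd X (i + 1 + 1) (i + 1 + 1 + 1) a = 0.
  by rewrite -[LHS]opprK ea oppr0.
have [|a' [b' [ea' eb']]] := fP i a b da; first by rewrite -[RHS]eb tr_id.
by exists (a', b'); rewrite /cone_fun /= tr_id ea' eb'.
Qed.

(** A cycle of the cone is moved into the kernel of [f] by lifting its second
    component along [f]. *)
Lemma quasi_iso_surj X Y (f : chmap X Y) : (forall i, surj (f i)) ->
  (forall i (a : X (i + 1)), cd X _ (i + 1 + 1) a = 0 -> f _ a = 0 ->
     exists2 a', cd X i _ a' = a & f _ a' = 0) -> quasi_iso f.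
Proof.
move=> fs fk; apply: quasi_isoP => i a b da e.
have [a0 fa0] := fs _ b.
have [||a1 da1 fa1] := fk _ (a + cd X (i + 1) (i + 1 + 1) a0).
- by rewrite raddfD /= da cd_sq addr0.
- by rewrite raddfD /= cm_d fa0.
exists (a0 - a1), 0; rewrite raddf0 addr0 (linearB (cd X _ _)) (linearB (f _)) /=.
rewrite da1 fa0 fa1 subr0.
by split=> //; rewrite opprB addrK.
Qed.

(** The condition says that the cokernel is acyclic, in terms of representatives:
    quotient complexes are never formed. *)
Lemma quasi_iso_inj X Y (f : chmap X Y) : (forall i, injective (f i)) ->
  (forall i (a : X (i + 1 + 1)) (b : Y (i + 1)), cd Y _ _ b = f _ a ->
    exists a' b', b = f _ a' + cd Y i _ b') -> quasi_iso f.
Proof.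
move=> fi fk; apply: quasi_isoP => i a b da e.
have [|a' [b' eb]] := fk i (- a) b.
  by rewrite raddfN /= (addr0_eq e).
exists a', b'; split=> //; apply: fi; rewrite raddfN /= cm_d.
have -> : f _ a = - cd Y _ (i + 1 + 1) b by apply/eqP; rewrite -addr_eq0 e.
by rewrite eb raddfD /= cd_sq addr0.
Qed.

Lemma quasi_iso_bij X Y (f : chmap X Y) :
  (forall i, injective (f i)) -> (forall i, surj (f i)) -> quasi_iso f.
Proof.
move=> fi fs; apply: quasi_iso_surj => // i a _ fa.
by exists 0; rewrite ?raddf0 //; apply: fi; rewrite fa raddf0.
Qed.

Definition toDb X Y (f : chmap X Y) : @hom (Db R) X Y := loc (@acyclic_sh R) f.
Definition toDsg (X Y : Db R) (f : hom X Y) : @hom (Dsg R) X Y :=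
  loc (@perfect_sh R) f.

Lemma quasi_iso_Db X Y (f : chmap X Y) : quasi_iso f -> is_iso (toDb f).
Proof.
move=> qf; apply: loc_cone_iso; exists (cone f), (cone_inj f), (cone_proj f).
by split=> //; apply: tri_closure_base; apply: ConeTri.
Qed.

Lemma quasi_iso_Dsg X Y (f : chmap X Y) : quasi_iso f -> @isomorphic (Dsg R) X Y.
Proof.
by move=> qf; exists (toDsg (toDb f)); apply: loc_iso; apply: quasi_iso_Db.
Qed.

Definition ses A B Z (f : chmap A B) (g : chmap B Z) : Prop :=
  forall i, [/\ injective (f i), exact_at (f i) (g i) & surj (g i)].

Section ShortExact.
Variables (A B Z : cpx R) (f : chmap A B) (g : chmap B Z).
Hypothesis fg : ses f g.

Lemma ses0 i x : g i (f i x) = 0.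
Proof. by have [_ e _] := fg i; apply/e; exists x. Qed.

Definition ses_cone_fun i (z : cone f i) : Z i := g i z.2.
Lemma ses_cone_linear i : linear (@ses_cone_fun i).
Proof. by move=> a u v; rewrite /ses_cone_fun /= linearP. Qed.
HB.instance Definition _ i := GRing.isLinear.Build R (cone f i) (Z i) *:%R
  (@ses_cone_fun i) (@ses_cone_linear i).
Lemma ses_cone_d i j z : ses_cone_fun (cd (cone f) i j z) = cd Z i j (ses_cone_fun z).
Proof.
rewrite /ses_cone_fun /= raddfD /= cm_d.
have [<-|/eqP ne] := eqVneq (i + 1) j; first by rewrite tr_id ses0 add0r.
by rewrite tr_ne // raddf0 add0r.
Qed.
Definition ses_cone : chmap (cone f) Z :=
  @ChMap R (cone f) Z (fun i => @ses_cone_fun i) ses_cone_d.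

Lemma ses_cone_quasi_iso : quasi_iso ses_cone.
Proof.
apply: quasi_iso_surj => [i z|i [a b]] /=.
  by have [_ _ /(_ z)[b bz]] := fg i; exists (0, b).
rewrite /ses_cone_fun /= => -[_]; rewrite tr_id => e gb.
have [_ /(_ b)[/(_ gb)[a' ea'] _] _] := fg (i + 1).
exists (a', 0); last by rewrite raddf0.
rewrite /cone_fun /= tr_id raddf0 addr0 ea'; congr pair.
have [fi _ _] := fg (i + 1 + 1); apply: fi; rewrite raddfN /= cm_d ea'.
by rewrite -(addr0_eq e) opprK.
Qed.

Definition ses_sh_fun i (x : sh_cpx 1 A i) : cone g i := (f _ x, 0).
Lemma ses_sh_linear i : linear (@ses_sh_fun i).
Proof.
by move=> a u v; rewrite /ses_sh_fun /= linearP; congr pair; rewrite /= scaler0 addr0.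
Qed.
HB.instance Definition _ i := GRing.isLinear.Build R (sh_cpx 1 A i) (cone g i) *:%R
  (@ses_sh_fun i) (@ses_sh_linear i).
Lemma ses_sh_d i j z : ses_sh_fun (cd (sh_cpx 1 A) i j z) = cd (cone g) i j (ses_sh_fun z).
Proof.
rewrite /ses_sh_fun /= /cone_fun /sh_d /= raddfN /= cm_d; congr pair.
by rewrite ses0 !raddf0 addr0.
Qed.
Definition ses_sh : chmap (sh_cpx 1 A) (cone g) :=
  @ChMap R (sh_cpx 1 A) (cone g) (fun i => @ses_sh_fun i) ses_sh_d.

Lemma ses_sh_quasi_iso : quasi_iso ses_sh.
Proof.
apply: quasi_iso_inj => [i x y [exy]|i a [b c] [eb ec]] /=.
  by have [fi _ _] := fg (i + 1); apply: fi.
rewrite tr_id in ec.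
have [_ _ /(_ c)[b' ec']] := fg (i + 1).
have : g (i + 1 + 1) (b + cd B _ _ b') = 0 by rewrite raddfD /= cm_d ec' ec.
have [_ e _] := fg (i + 1 + 1); case/e => a' ea'.
exists a', (b', 0); rewrite /ses_sh_fun /cone_fun /= tr_id ea' raddf0 addr0 ec'.
by congr pair; rewrite /= ?addrK ?add0r.
Qed.

(** The connecting morphism goes back along the quasi-isomorphism from the cone of
    [f] to [Z], so it exists in [Db] only. *)
Lemma ses_dist : exists h, @dist (Db R) A B Z (toDb f) (toDb g) h.
Proof.
have [k [kc ck]] := quasi_iso_Db ses_cone_quasi_iso.
exists (toDb (cone_proj f) oo k).
have D : @dist (Kb R) _ _ _ f (cone_inj f) (cone_proj f).
  by apply: tri_closure_base; apply: ConeTri.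
apply: tri_closure_iso (loc_dist (@acyclic_sh R) D) _.
exists (@idm (Db R) A), (@idm (Db R) B), (toDb ses_cone).
split; first by split; try exact: is_iso_idm; exists k.
split; first by rewrite cmp1l cmp1r.
  rewrite cmp1r /toDb -loc_cmp; apply: loc_heq; apply: homotopic_eq => i x.
  by rewrite /= /ses_cone_fun /=.
by rewrite shm_id cmp1l -cmpA kc cmp1r.
Qed.

Lemma ses_dist_Dsg : exists h,
  @dist (Dsg R) A B Z (toDsg (toDb f)) (toDsg (toDb g)) h.
Proof.
have [h D] := ses_dist; exists (toDsg h).
exact: (loc_dist (@perfect_sh R) D).
Qed.

(** The cokernel is a cone of [f] in [Db], and it is perfect. *)
Lemma ses_proj_coker : (forall i, projective (Z i)) -> @isomorphic (Dsg R) A B.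
Proof.
move=> Zp; exists (toDsg (toDb f)); apply: loc_cone_iso.
have [h D] := ses_dist; exists Z, (toDb g), h; split=> //.
by exists Z; split=> //; apply: isomorphic_refl.
Qed.
End ShortExact.
End QuasiIsomorphisms.

Section ShortExactCorollaries.
Variable R : pzRingType.

Lemma cone_ses (X Y : cpx R) (f : chmap X Y) : ses (cone_inj f) (cone_proj f).
Proof.
move=> i; split=> [x y [] //|[x y]|x] /=; last by exists (x, 0).
by split=> [/= ->|[y' [<- _]]//]; exists y.
Qed.

(** The cokernel of the inclusion of [X] into the cone is a shift of [P]. *)
Lemma cone_from_proj (P X : cpx R) (f : chmap P X) :
  (forall i, projective (P i)) -> @isomorphic (Dsg R) X (cone f).
Proof. by move=> Pp; apply: ses_proj_coker (cone_ses f) _ => i; apply: Pp. Qed.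

(** Both [Z] and the shift of [A] are compared with the cone of [g]. *)
Lemma ses_proj_middle (A B Z : cpx R) (f : chmap A B) (g : chmap B Z) :
  ses f g -> (forall i, projective (B i)) -> @isomorphic (Dsg R) Z (sh_cpx 1 A).
Proof.
move=> fg Bp; apply: isomorphic_trans (cone_from_proj g Bp) _.
by apply: (@isomorphic_sym (Dsg R)); apply: quasi_iso_Dsg (@ses_sh_quasi_iso _ _ _ _ _ _ fg).
Qed.
End ShortExactCorollaries.

(** * Coproducts of complexes *)

Section HomotopyCoproducts.
Variable R : pzRingType.
Implicit Types X Y Z W : cpx R.

Section ChAdd.
Variables (X Y : cpx R) (f g : chmap X Y).
Lemma ch_add_d i j x :
  (f j \+ g j) (cd X i j x) = cd Y i j ((f i \+ g i) x).
Proof. by rewrite /= !cm_d raddfD. Qed.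
Definition ch_add : chmap X Y := @ChMap R X Y (fun i => f i \+ g i) ch_add_d.
End ChAdd.

(** The projections make the coproduct survive the passage to homotopy classes:
    homotopies on the two summands combine to one on [S]. *)
Lemma split_coprod2 X Y S (i : chmap X S) (j : chmap Y S) (p : chmap S X)
    (q : chmap S Y) :
  (forall n x, p n (i n x) = x) -> (forall n y, q n (j n y) = y) ->
  (forall n y, p n (j n y) = 0) -> (forall n x, q n (i n x) = 0) ->
  (forall n s, i n (p n s) + j n (q n s) = s) ->
  @is_coprod2 (Kb R) X Y S i j.
Proof.
move=> pi qj pj qi e Z f g; exists (ch_add (ch_cmp f p) (ch_cmp g q)).
split=> [||v [h hP] [k kP]].
- by apply: homotopic_eq => n x; rewrite /= pi qi raddf0 addr0.
- by apply: homotopic_eq => n x; rewrite /= pj qj raddf0 add0r.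
exists (fun a b => (h a b \o p a) \+ (k a b \o q a)) => a b c ab bc x /=.
have := hP a b c ab bc (p b x); rewrite /= -(cm_d p) => E1.
have := kP a b c ab bc (q b x); rewrite /= -(cm_d q) => E2.
rewrite (raddfD (cd Z a b)) /= addrACA -E1 -E2 -{1}(e b x) (raddfD (v b)) /= opprD.
by rewrite addrACA.
Qed.

Section Sum.
Variables X W : cpx R.
Definition sum_fun i j (z : fg_prod (X i) (W i)) : fg_prod (X j) (W j) :=
  (cd X i j z.1, cd W i j z.2).
Lemma sum_linear i j : linear (@sum_fun i j).
Proof. by move=> a u v; rewrite /sum_fun /= !linearP. Qed.
HB.instance Definition _ i j := GRing.isLinear.Build R (fg_prod (X i) (W i))
  (fg_prod (X j) (W j)) *:%R (@sum_fun i j) (@sum_linear i j).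
Lemma sum_shape i j : i + 1 <> j -> forall z, @sum_fun i j z = 0.
Proof. by move=> ij z; rewrite /sum_fun !cd_shape. Qed.
Lemma sum_sq i j k z : @sum_fun j k (@sum_fun i j z) = 0.
Proof. by rewrite /sum_fun /= !cd_sq. Qed.
Lemma sum_bnd : exists N : nat, forall i : int, (N < `|i|)%N ->
  forall z : fg_prod (X i) (W i), z = 0.
Proof.
have [N NP] := cbnd X; have [N' N'P] := cbnd W.
exists (maxn N N') => i; rewrite gtn_max => /andP[Ni N'i] [x y].
by rewrite (NP i Ni x) (N'P i N'i y).
Qed.
Definition sum_cpx : cpx R :=
  @Cpx R (fun i => fg_prod (X i) (W i)) (fun i j => @sum_fun i j)
    sum_shape sum_sq sum_bnd.

Definition inl_fun i (x : X i) : sum_cpx i := (x, 0).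
Lemma inl_linear i : linear (@inl_fun i).
Proof. by move=> a u v; congr pair; rewrite /= scaler0 addr0. Qed.
HB.instance Definition _ i := GRing.isLinear.Build R (X i) (sum_cpx i) *:%R
  (@inl_fun i) (@inl_linear i).
Lemma inl_d i j x : inl_fun (cd X i j x) = cd sum_cpx i j (inl_fun x).
Proof. by rewrite /= /sum_fun /= raddf0. Qed.
Definition sum_inl : chmap X sum_cpx := @ChMap R X sum_cpx (fun i => @inl_fun i) inl_d.

Definition inr_fun i (x : W i) : sum_cpx i := (0, x).
Lemma inr_linear i : linear (@inr_fun i).
Proof. by move=> a u v; congr pair; rewrite /= scaler0 addr0. Qed.
HB.instance Definition _ i := GRing.isLinear.Build R (W i) (sum_cpx i) *:%R
  (@inr_fun i) (@inr_linear i).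
Lemma inr_d i j x : inr_fun (cd W i j x) = cd sum_cpx i j (inr_fun x).
Proof. by rewrite /= /sum_fun /= raddf0. Qed.
Definition sum_inr : chmap W sum_cpx := @ChMap R W sum_cpx (fun i => @inr_fun i) inr_d.

Definition sum_fst : chmap sum_cpx X :=
  @ChMap R sum_cpx X (fun i => fst) (fun i j z => erefl).
Definition sum_snd : chmap sum_cpx W :=
  @ChMap R sum_cpx W (fun i => snd) (fun i j z => erefl).

Lemma sum_coprod2 : @is_coprod2 (Kb R) X W sum_cpx sum_inl sum_inr.
Proof.
apply: (@split_coprod2 _ _ _ _ _ sum_fst sum_snd) => // n [x y].
by congr pair; rewrite /= ?addr0 ?add0r.
Qed.
End Sum.

Section SumCone.
Variables (X Y W : cpx R) (f : chmap X Y).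
Definition sum_mapl_fun i (z : sum_cpx X W i) : sum_cpx Y W i := (f i z.1, z.2).
Lemma sum_mapl_linear i : linear (@sum_mapl_fun i).
Proof. by move=> a u v; rewrite /sum_mapl_fun /= linearP. Qed.
HB.instance Definition _ i := GRing.isLinear.Build R (sum_cpx X W i) (sum_cpx Y W i) *:%R
  (@sum_mapl_fun i) (@sum_mapl_linear i).
Lemma sum_mapl_d i j z :
  sum_mapl_fun (cd (sum_cpx X W) i j z) = cd (sum_cpx Y W) i j (sum_mapl_fun z).
Proof. by rewrite /= /sum_fun /sum_mapl_fun /= cm_d. Qed.
Definition sum_mapl : chmap (sum_cpx X W) (sum_cpx Y W) :=
  @ChMap R (sum_cpx X W) (sum_cpx Y W) (fun i => @sum_mapl_fun i) sum_mapl_d.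

Lemma tr_sum i j (z : sum_cpx Y W i) :
  tr (sum_cpx Y W) i j z = (tr Y i j z.1, tr W i j z.2).
Proof.
have [<-|/eqP ne] := eqVneq i j; first by rewrite !tr_id; case: z.
by rewrite !tr_ne.
Qed.

Definition cone_sum_out_fun i (z : cone sum_mapl i) : cone f i := (z.1.1, z.2.1).
Lemma cone_sum_out_linear i : linear (@cone_sum_out_fun i). Proof. by []. Qed.
HB.instance Definition _ i := GRing.isLinear.Build R (cone sum_mapl i) (cone f i) *:%R
  (@cone_sum_out_fun i) (@cone_sum_out_linear i).
Lemma cone_sum_out_d i j z :
  cone_sum_out_fun (cd (cone sum_mapl) i j z) = cd (cone f) i j (cone_sum_out_fun z).
Proof. by rewrite /= /cone_fun /cone_sum_out_fun tr_sum. Qed.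
Definition cone_sum_out : chmap (cone sum_mapl) (cone f) :=
  @ChMap R (cone sum_mapl) (cone f) (fun i => @cone_sum_out_fun i) cone_sum_out_d.

Definition cone_sum_in_fun i (z : cone f i) : cone sum_mapl i := ((z.1, 0), (z.2, 0)).
Lemma cone_sum_in_linear i : linear (@cone_sum_in_fun i).
Proof.
move=> a u v; rewrite /cone_sum_in_fun.
by congr pair; congr pair; rewrite /= scaler0 addr0.
Qed.
HB.instance Definition _ i := GRing.isLinear.Build R (cone f i) (cone sum_mapl i) *:%R
  (@cone_sum_in_fun i) (@cone_sum_in_linear i).
Lemma cone_sum_in_d i j z :
  cone_sum_in_fun (cd (cone f) i j z) = cd (cone sum_mapl) i j (cone_sum_in_fun z).
Proof.
rewrite /= /cone_fun /cone_sum_in_fun tr_sum /= /sum_fun /= !raddf0.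
by congr pair; congr pair; rewrite /= ?oppr0 ?addr0.
Qed.
Definition cone_sum_in : chmap (cone f) (cone sum_mapl) :=
  @ChMap R (cone f) (cone sum_mapl) (fun i => @cone_sum_in_fun i) cone_sum_in_d.

(** The cone of the identity of [W] is contracted by moving its second copy of [W]
    onto the first. *)
Definition cone_sum_htpy_fun i j (z : cone sum_mapl i) : cone sum_mapl j :=
  ((0, tr W i (j + 1) z.2.2), 0).
Lemma cone_sum_htpy_linear i j : linear (@cone_sum_htpy_fun i j).
Proof.
move=> a u v; rewrite /cone_sum_htpy_fun /= linearP.
by congr pair; [congr pair|]; rewrite /= scaler0 addr0.
Qed.
HB.instance Definition _ i j := GRing.isLinear.Build R (cone sum_mapl i) (cone sum_mapl j) *:%R
  (@cone_sum_htpy_fun i j) (@cone_sum_htpy_linear i j).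

Lemma cone_sum_iso : @isomorphic (Kb R) (cone sum_mapl) (cone f).
Proof.
exists cone_sum_out, cone_sum_in; split; last by apply: homotopic_eq => i [].
apply: homotopic_sym; exists (fun i j => @cone_sum_htpy_fun i j : {linear _ -> _}).
move=> p _ _ <- <- [[x w] [y w']] /=.
rewrite /cone_sum_in_fun /cone_sum_out_fun /cone_fun /cone_sum_htpy_fun /= !tr_sum /=.
rewrite /sum_fun /sum_mapl_fun /= !tr_id.
rewrite !raddf0.
congr pair; congr pair; rewrite /= ?addr0 ?subrr ?subr0 ?oppr0 ?addr0 ?add0r //.
by rewrite [RHS]addrC addrK.
Qed.
End SumCone.

Lemma Kb_cop (X Y : Kb R) : exists S (i : hom X S) (j : hom Y S), is_coprod2 i j.
Proof. by exists (sum_cpx X Y), (sum_inl X Y), (sum_inr X Y); apply: sum_coprod2. Qed.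

Lemma Kb_sum_closed : sum_closed (@dist (Kb R)).
Proof.
apply: sum_closed_closure => A B E a b c D W; case: D => {A B E a b c} X Y f.
exists (sum_cpx X W), (sum_cpx Y W), (sum_inl X W), (sum_inr X W), (sum_inl Y W),
  (sum_inr Y W), (sum_mapl W f); split; try exact: sum_coprod2.
- apply: homotopic_eq => i x; by [].
- apply: homotopic_eq => i x; by rewrite /= /sum_mapl_fun /= raddf0.
have [e ei] := cone_sum_iso W f.
apply: tri_closure_transport (tri_closure_base (ConeTri (sum_mapl W f)))
  (is_iso_idm _) (is_iso_idm _) ei _.
by rewrite cmp1l cmp1r.
Qed.

Lemma Db_cop (X Y : Db R) : exists S (i : hom X S) (j : hom Y S), is_coprod2 i j.
Proof. exact: (loc_cop Kb_sum_closed Kb_cop). Qed.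

Lemma Db_sum_closed : sum_closed (@dist (Db R)).
Proof. exact: (loc_sum_closed Kb_sum_closed Kb_cop). Qed.

Lemma Dsg_coprod2 X Y S (i : chmap X S) (j : chmap Y S) :
  @is_coprod2 (Kb R) X Y S i j -> is_coprod2 (toDsg (toDb i)) (toDsg (toDb j)).
Proof.
move=> ij; apply: (loc_coprod2 Db_sum_closed Db_cop).
exact: (loc_coprod2 Kb_sum_closed Kb_cop).
Qed.

Lemma zero_fin_gen : fin_gen ({ffun 'I_0 -> R^o} : lmodType R).
Proof.
exists 0%N, (fun=> 0) => x; exists (fun=> 0); rewrite big_ord0.
by apply/ffunP => -[].
Qed.
Definition zero_fg : fgmod R := FgMod zero_fin_gen.
Lemma zero_fgE (x : zero_fg) : x = 0.
Proof. by apply/ffunP => -[]. Qed.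

Lemma zero_bnd : exists N : nat, forall i : int, (N < `|i|)%N ->
  forall x : zero_fg, x = 0.
Proof. by exists 0%N => i _; apply: zero_fgE. Qed.
Definition zero_cpx : cpx R :=
  @Cpx R (fun=> zero_fg) (fun i j => \0) (fun i j _ x => erefl)
    (fun i j k x => erefl) zero_bnd.
Definition zero_map X : chmap zero_cpx X :=
  @ChMap R zero_cpx X (fun i => \0) (fun i j x => esym (raddf0 _)).

Lemma Dsg_initial : initial (C := Dsg R) (fun X => toDsg (toDb (zero_map X))).
Proof.
apply: loc_initial; apply: loc_initial => X f.
by apply: homotopic_eq => i x; rewrite (zero_fgE x) !raddf0.
Qed.

End HomotopyCoproducts.

(** * Subcomplexes and stalk complexes *)

Section Submodules.
Variables (R : pzRingType) (M : lmodType R) (S : M -> Prop) (hS : is_submod S).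

(** The proof [hS] is an argument so that the closure instance can be found from
    the predicate. *)
Definition smem of is_submod S : {pred M} := fun x => `[< S x >].
Lemma smem_closed : submod_closed (smem hS).
Proof.
case: (hS) => S0 SD SZ; split=> [|a x y /asboolP Sx /asboolP Sy]; apply/asboolP => //.
by apply: SD => //; apply: SZ.
Qed.
HB.instance Definition _ := GRing.isSubmodClosed.Build R M (smem hS) smem_closed.

Inductive subm : predArgType := Subm x of x \in smem hS.
Definition subm_val u := let: Subm x _ := u in x.
HB.instance Definition _ := [isSub of subm for subm_val].
HB.instance Definition _ := [Choice of subm by <:].
HB.instance Definition _ := [SubChoice_isSubLmodule of subm by <:].

Lemma submP (u : subm) : S (val u).
Proof. exact: (asboolP _ (valP u)). Qed.
Definition mk_subm x (Sx : S x) : subm := Subm (introT (asboolP _) Sx).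
End Submodules.

Lemma mod_isoP (R : pzRingType) (P Q : lmodType R) : mod_iso P Q ->
  exists (f : {linear P -> Q}) (g : {linear Q -> P}), cancel f g /\ cancel g f.
Proof.
case=> f [g fg gf].
by exists f, (HB.pack_for {linear Q -> P} g
  (GRing.isLinear.Build _ _ _ _ g (can2_linear fg gf))).
Qed.

Lemma projective_iso (R : pzRingType) (P Q : lmodType R) :
  mod_iso P Q -> projective P -> projective Q.
Proof.
case/mod_isoP=> e [e' [ee' e'e]] Pp M N g f gs.
have [h hP] := Pp M N g (f \o e) gs.
by exists (h \o e') => x; rewrite /= hP /= e'e.
Qed.

Lemma projective0 (R : pzRingType) (P : lmodType R) :
  (forall x : P, x = 0) -> projective P.
Proof. by move=> P0 M N g f _; exists \0 => x; rewrite (P0 x) !raddf0. Qed.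

Section SubmoduleMaps.
Variable R : pzRingType.

Section Map.
Variables (M N : lmodType R) (S : M -> Prop) (hS : is_submod S)
  (S' : N -> Prop) (hS' : is_submod S') (f : {linear M -> N}).
Hypothesis fS : forall x, S x -> S' (f x).
Definition subm_map_fun (u : subm hS) : subm hS' := mk_subm hS' (fS (submP u)).
Lemma subm_map_linear : linear subm_map_fun.
Proof. by move=> a u v; apply: val_inj; rewrite /= !linearP. Qed.
HB.instance Definition _ := GRing.isLinear.Build R (subm hS) (subm hS') *:%R
  subm_map_fun subm_map_linear.
Definition subm_map : {linear subm hS -> subm hS'} := subm_map_fun.
End Map.

Section Corestriction.
Variables (M N : lmodType R) (S' : N -> Prop) (hS' : is_submod S') (f : {linear M -> N}).
Hypothesis fS : forall x, S' (f x).
Definition subm_cor_fun (x : M) : subm hS' := mk_subm hS' (fS x).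
Lemma subm_cor_linear : linear subm_cor_fun.
Proof. by move=> a u v; apply: val_inj; rewrite /= !linearP. Qed.
HB.instance Definition _ := GRing.isLinear.Build R M (subm hS') *:%R
  subm_cor_fun subm_cor_linear.
Definition subm_cor : {linear M -> subm hS'} := subm_cor_fun.
End Corestriction.

Definition subm_inc (M : lmodType R) (S : M -> Prop) (hS : is_submod S) :
  {linear subm hS -> M} := val.

Lemma subm_full (M : lmodType R) (S : M -> Prop) (hS : is_submod S) :
  (forall x, S x) -> mod_iso M (subm hS).
Proof.
move=> Sx; exists (subm_cor hS (f := idfun) Sx); exists val => // u.
exact: val_inj.
Qed.

Lemma subm_zero (M : lmodType R) (S : M -> Prop) (hS : is_submod S) :
  (forall x, S x -> x = 0) -> forall u : subm hS, u = 0.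
Proof. by move=> S0 u; apply: val_inj; rewrite /= (S0 _ (submP u)). Qed.
End SubmoduleMaps.

Definition noetherian (R : pzRingType) : Prop :=
  forall (M : fgmod R) (S : M -> Prop), is_submod S ->
  exists n (g : 'I_n -> M), (forall i, S (g i)) /\
    forall x, S x -> exists c : 'I_n -> R, x = \sum_i c i *: g i.

Section Noetherian.
Variables (R : pzRingType) (nR : noetherian R).

Lemma subm_fin_gen (M : fgmod R) (S : M -> Prop) (hS : is_submod S) :
  fin_gen (subm hS).
Proof.
have [n [g [Sg gP]]] := nR hS.
exists n, (fun i => mk_subm hS (Sg i)) => u.
have [c cP] := gP _ (submP u); exists c; apply: val_inj; rewrite /= cP.
have -> : val (\sum_(i < n) c i *: mk_subm hS (Sg i)) =
  subm_inc hS (\sum_(i < n) c i *: mk_subm hS (Sg i)) by [].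
by rewrite linear_sum; apply: eq_bigr => i _; rewrite linearZ.
Qed.
Definition sub_fg (M : fgmod R) (S : M -> Prop) (hS : is_submod S) : fgmod R :=
  FgMod (subm_fin_gen hS).

(* Brutal and soft truncations are both subcomplexes cut out by a predicate, which
   keeps the underlying modules in their degrees. *)
Section Subcomplex.
Variables (X : cpx R) (S : forall i, X i -> Prop).
Hypotheses (hS : forall i, is_submod (@S i))
  (dS : forall i j x, S x -> S (cd X i j x)).
Definition sub_ob i : fgmod R := sub_fg (hS i).
Definition sub_d i j : {linear sub_ob i -> sub_ob j} :=
  subm_map (hS i) (hS j) (@dS i j).
Lemma sub_shape i j : i + 1 <> j -> forall x, sub_d i j x = 0.
Proof. by move=> ij x; apply: val_inj; rewrite /= cd_shape. Qed.
Lemma sub_sq i j k x : sub_d j k (sub_d i j x) = 0.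
Proof. by apply: val_inj; rewrite /= cd_sq. Qed.
Lemma sub_bnd :
  exists N : nat, forall i : int, (N < `|i|)%N -> forall x : sub_ob i, x = 0.
Proof.
by have [N NP] := cbnd X; exists N => i Ni x; apply: val_inj; apply: NP.
Qed.
Definition sub_cpx : cpx R := Cpx sub_shape sub_sq sub_bnd.
Definition sub_inc : chmap sub_cpx X :=
  @ChMap R sub_cpx X (fun i => subm_inc (hS i)) (fun i j x => erefl).
End Subcomplex.

Section Stalk.
Variables (c : int) (M : fgmod R).
(** A submodule of [M] in every degree, instead of a case distinction between [M]
    and [0], so that no transport along equalities of degrees is needed. *)
Definition stalk_pred (i : int) (x : M) : Prop := i <> c -> x = 0.
Lemma stalk_submod i : is_submod (stalk_pred i).
Proof.
split=> // [x y hx hy ic|a x hx ic]; first by rewrite hx // hy // addr0.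
by rewrite hx // scaler0.
Qed.
Definition stalk_ob i : fgmod R := sub_fg (stalk_submod i).
Lemma stalk_shape i j : i + 1 <> j -> forall x, (\0 : {linear stalk_ob i -> stalk_ob j}) x = 0.
Proof. by []. Qed.
Lemma stalk_sq i j k x :
  (\0 : {linear stalk_ob j -> stalk_ob k}) ((\0 : {linear stalk_ob i -> stalk_ob j}) x) = 0.
Proof. by []. Qed.
Lemma stalk_bnd :
  exists N : nat, forall i : int, (N < `|i|)%N -> forall x : stalk_ob i, x = 0.
Proof.
exists `|c|%N => i ci; apply: subm_zero => x; apply => ic.
by move: ci; rewrite ic ltnn.
Qed.
Definition stalk : cpx R := Cpx stalk_shape stalk_sq stalk_bnd.

Lemma stalk0 i (x : stalk i) : i <> c -> x = 0.
Proof. by move=> ic; apply: val_inj; apply: (submP x). Qed.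

Lemma stalk_proj : projective M -> forall i, projective (stalk i).
Proof.
move=> Mp i; have [ic|/eqP ic] := eqVneq i c.
  by apply: projective_iso Mp; apply: subm_full => x; rewrite /stalk_pred ic.
by apply: projective0 => x; apply: stalk0.
Qed.

Variable X : cpx R.
Section To.
Variable phi : {linear X c -> M}.
Hypothesis phi_d : forall i x, phi (cd X i c x) = 0.
Lemma to_stalk_pred i x : stalk_pred i ((phi \o tr X i c) x).
Proof. by move=> ic; rewrite /= tr_ne // raddf0. Qed.
Definition to_stalk_fun i : {linear X i -> stalk i} :=
  subm_cor (stalk_submod i) (@to_stalk_pred i).
Lemma to_stalk_d i j x : to_stalk_fun j (cd X i j x) = cd stalk i j (to_stalk_fun i x).
Proof.
apply: val_inj; rewrite /=; have [e|/eqP jc] := eqVneq j c.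
  by subst j; rewrite tr_id phi_d.
by rewrite tr_ne // raddf0.
Qed.
Definition to_stalk : chmap X stalk := @ChMap R X stalk to_stalk_fun to_stalk_d.
End To.
Section From.
Variable phi : {linear M -> X c}.
Hypothesis phi_d : forall j m, cd X c j (phi m) = 0.
Definition from_stalk_fun i : {linear stalk i -> X i} :=
  tr X c i \o (phi \o subm_inc (stalk_submod i)).
Lemma from_stalk_d i j x : from_stalk_fun j (cd stalk i j x) = cd X i j (from_stalk_fun i x).
Proof.
rewrite /= !raddf0; have [e|/eqP ic] := eqVneq c i.
  by subst i; rewrite tr_id phi_d.
by rewrite (tr_ne _ ic) raddf0.
Qed.
Definition from_stalk : chmap stalk X := @ChMap R stalk X from_stalk_fun from_stalk_d.
End From.
End Stalk.

Section StalkMap.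
Variables (c : int) (M N : fgmod R) (phi : {linear M -> N}).
Lemma stalk_map_pred i x : stalk_pred c i x -> stalk_pred c i (phi x).
Proof. by move=> xP ic; rewrite xP // raddf0. Qed.
Definition stalk_map_fun i : {linear stalk c M i -> stalk c N i} :=
  subm_map (stalk_submod c M i) (stalk_submod c N i) (@stalk_map_pred i).
Lemma stalk_map_d i j x :
  stalk_map_fun j (cd (stalk c M) i j x) = cd (stalk c N) i j (stalk_map_fun i x).
Proof. by rewrite /= raddf0. Qed.
Definition stalk_map : chmap (stalk c M) (stalk c N) :=
  @ChMap R (stalk c M) (stalk c N) stalk_map_fun stalk_map_d.
End StalkMap.

Section StalkShift.
Variables (n c : int) (M : fgmod R).
Lemma stalk_sh_pred i x : stalk_pred (M := M) (c - n) i x -> stalk_pred c (i + n) x.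
Proof. by move=> xP ic; apply: xP => e; apply: ic; rewrite e subrK. Qed.
Definition stalk_sh_fun i : {linear stalk (c - n) M i -> sh_cpx n (stalk c M) i} :=
  subm_map (stalk_submod (c - n) M i) (stalk_submod c M (i + n)) (f := idfun)
    (@stalk_sh_pred i).
Lemma stalk_sh_d i j x : stalk_sh_fun j (cd (stalk (c - n) M) i j x) =
  cd (sh_cpx n (stalk c M)) i j (stalk_sh_fun i x).
Proof. by rewrite [LHS]raddf0 /= /sh_d signlE /= scaler0. Qed.
Definition stalk_sh : chmap (stalk (c - n) M) (sh_cpx n (stalk c M)) :=
  @ChMap R _ _ stalk_sh_fun stalk_sh_d.
Lemma stalk_sh_quasi_iso : quasi_iso stalk_sh.
Proof.
apply: quasi_iso_bij => i.
  by move=> u v e; apply: val_inj; exact: (congr1 val e).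
move=> u; have h : stalk_pred (M := M) (c - n) i (val u).
  by move=> ic; apply: (submP u) => e; apply: ic; rewrite -e addrK.
by exists (mk_subm (stalk_submod (c - n) M i) h); apply: val_inj.
Qed.
Lemma stalk_shift : @isomorphic (Dsg R) (stalk (c - n) M) (sh_cpx n (stalk c M)).
Proof. exact: quasi_iso_Dsg (@stalk_sh_quasi_iso). Qed.
End StalkShift.

End Noetherian.

(** * Every object of the singularity category is a shifted module *)

Lemma free_cover (R : pzRingType) (M : fgmod R) :
  exists (P : fgmod R) (p : {linear P -> M}), projective P /\ surj p.
Proof.
have [n [g gP]] := fg_prop M.
have fgF : fin_gen ({ffun 'I_n -> R^o} : lmodType R).
  exists n, (fun i => [ffun j => (j == i)%:R]) => x; exists x.
  apply/ffunP => j; rewrite sum_ffunE (bigD1 j) //= !ffunE eqxx big1.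
    by rewrite addr0 /GRing.scale /= mulr1.
  by move=> i ij; rewrite !ffunE eq_sym (negbTE ij) /GRing.scale /= mulr0.
have comb (N : lmodType R) (h : 'I_n -> N) :
    exists H : {linear {ffun 'I_n -> R^o} -> N}, forall x, H x = \sum_i (x i : R) *: h i.
  pose H (x : {ffun 'I_n -> R^o}) := \sum_i (x i : R) *: h i.
  have Hlin : linear H.
    move=> a u v; rewrite /H scaler_sumr -big_split; apply: eq_bigr => i _.
    by rewrite !ffunE scalerDl scalerA.
  by exists (HB.pack_for {linear {ffun 'I_n -> R^o} -> N} H
    (GRing.isLinear.Build _ _ _ _ H Hlin)).
have [p pE] := comb M g.
exists (FgMod fgF), p; split; last first.
  by move=> y; have [c ->] := gP y; exists [ffun i => c i]; rewrite pE;
     apply: eq_bigr => i _; rewrite ffunE.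
move=> A B q f qs.
have lift i := cid (qs (f [ffun j => (j == i)%:R])).
have [h hE] := comb A (fun i => projT1 (lift i)).
exists h => x; rewrite hE linear_sum.
have {2}-> : x = \sum_i (x i : R) *: [ffun j : 'I_n => (j == i)%:R : R^o].
  apply/ffunP => j; rewrite sum_ffunE (bigD1 j) //= !ffunE eqxx big1.
    by rewrite addr0 /GRing.scale /= mulr1.
  by move=> i ij; rewrite !ffunE eq_sym (negbTE ij) /GRing.scale /= mulr0.
rewrite linear_sum; apply: eq_bigr => i _; rewrite !linearZ /=.
by case: (lift i) => /= y ->.
Qed.

Section Reduction.
Variables (R : pzRingType) (nR : noetherian R).
Local Notation stalk := (stalk nR).

Definition concentrated (a b : int) (X : cpx R) : Prop :=
  forall i, (i < a) || (b < i) -> forall x : X i, x = 0.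

(** The soft truncation at [c]: its inclusion is a quasi-isomorphism because the
    only differential that is cut off is onto. *)
Lemma truncation (a c : int) (X : cpx R) : concentrated a (c + 1) X ->
  surj (cd X c (c + 1)) ->
  exists Y : cpx R, concentrated a c Y /\ @isomorphic (Dsg R) Y X.
Proof.
move=> Xc ds.
pose S i (x : X i) := (c < i -> x = 0) /\ (c <= i -> forall j, cd X i j x = 0).
have hS i : is_submod (@S i).
  split; first by split=> // _ j; rewrite raddf0.
    move=> x y [x0 dx] [y0 dy]; split=> [ci|ci j]; first by rewrite x0 ?y0 ?addr0.
    by rewrite raddfD /= dx ?dy ?addr0.
  move=> r x [x0 dx]; split=> [ci|ci j]; first by rewrite x0 ?scaler0.
  by rewrite linearZ /= dx ?scaler0.
have dS i j x : S i x -> S j (cd X i j x).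
  move=> [x0 dx]; split=> [cj|cj l]; last exact: cd_sq.
  have [ij|/eqP ij] := eqVneq (i + 1) j; last exact: cd_shape.
  by apply: dx; lia.
exists (sub_cpx nR hS dS); split.
  move=> i ic; apply: subm_zero => x [x0 _].
  have [/x0 //|ci] := boolP (c < i); apply: Xc; lia.
apply: (@quasi_iso_Dsg _ _ _ (sub_inc nR hS dS)).
apply: quasi_iso_inj => [i|i u b eb]; first exact: val_inj.
have inS : S (i + 1) b -> exists a' b', b = sub_inc nR hS dS (i + 1) a' + cd X i (i + 1) b'.
  by move=> Sb; exists (mk_subm (hS _) Sb), 0; rewrite raddf0 addr0.
have [ic|ic] := boolP (i + 1 <= c); last first.
  have [e|/eqP ne] := eqVneq i c; last first.
    by apply: inS; rewrite (Xc _ _ b); [case: (hS (i + 1))|lia].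
  by subst i; have [b' <-] := ds b; exists 0, b'; exact: (esym (add0r _)).
apply: inS; split=> [|ci j]; first lia.
have [<-|/eqP ij] := eqVneq (i + 1 + 1) j; last exact: cd_shape.
by rewrite eb; case: (submP u : S _ (val u)) => + _; apply; lia.
Qed.

(** The cone of a surjection [P -> X (c + 1)] from a projective is isomorphic to [X] in
    [Dsg], and its last differential is onto. *)
Lemma lower_top (a c : int) (X : cpx R) : a <= c -> concentrated a (c + 1) X ->
  exists Y : cpx R, concentrated a c Y /\ @isomorphic (Dsg R) X Y.
Proof.
move=> ac Xc; have [P [p [Pp ps]]] := free_cover (X (c + 1)).
have pd j m : cd X (c + 1) j (p m) = 0.
  have [<-|/eqP ij] := eqVneq (c + 1 + 1) j; last exact: cd_shape.
  by apply: Xc; lia.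
pose f := from_stalk nR pd.
have [|[u x]|Y [Yc YX]] := @truncation a c (cone f).
- move=> i hi [u x]; congr pair; last exact: Xc.
  by apply: stalk0; lia.
- have [m mx] := ps x.
  have mP : stalk_pred (M := P) (c + 1) (c + 1) m by [].
  exists (mk_subm (stalk_submod (c + 1) P (c + 1)) mP, 0).
  rewrite /= /cone_fun; congr pair.
    by have -> : u = 0; [apply: stalk0; lia|exact: oppr0].
  by rewrite /= !tr_id mx raddf0; exact: addr0.
exists Y; split=> //.
apply: isomorphic_trans (cone_from_proj f (@stalk_proj _ nR _ _ Pp)) _.
exact: (@isomorphic_sym (Dsg R)).
Qed.

Lemma lower_all (n : nat) (a : int) (X : cpx R) : concentrated a (a + n%:Z) X ->
  exists Y : cpx R, concentrated a a Y /\ @isomorphic (Dsg R) X Y.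
Proof.
elim: n X => [|n IH] X Xc.
  by exists X; split; [rewrite addr0 in Xc|apply: isomorphic_refl].
have [||Y [/IH[Z [Zc YZ]] XY]] := @lower_top a (a + n%:Z) X.
- by lia.
- by move=> i hi; apply: Xc; lia.
by exists Z; split=> //; apply: isomorphic_trans XY YZ.
Qed.

Lemma concentrated_stalk (a : int) (X : cpx R) : concentrated a a X ->
  @isomorphic (Dsg R) X (stalk a (X a)).
Proof.
move=> Xc.
have dX i x : (idfun : {linear X a -> X a}) (cd X i a x) = 0.
  have [e|/eqP ij] := eqVneq (i + 1) a; last exact: cd_shape.
  by rewrite (Xc i _ x) ?raddf0 //; lia.
apply: (@quasi_iso_Dsg _ _ _ (to_stalk nR dX)).
apply: quasi_iso_bij => i.
  have [e|/eqP ia] := eqVneq i a.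
    by subst i => x y /(congr1 val); rewrite /= !tr_id.
  by move=> x y _; rewrite (Xc i _ x) ?(Xc i _ y) //; lia.
move=> u; have [e|/eqP ia] := eqVneq i a.
  by subst i; exists (val u); apply: val_inj; rewrite /= tr_id.
by exists 0; rewrite raddf0 (stalk0 u ia).
Qed.

Theorem reduce_stalk (X : cpx R) :
  exists (a : int) (M : fgmod R), @isomorphic (Dsg R) X (stalk a M).
Proof.
have [N NP] := cbnd X.
have [|Y [Yc XY]] := @lower_all (N + N) (- N%:Z) X.
  by move=> i hi; apply: NP; lia.
exists (- N%:Z), (Y (- N%:Z)).
exact: isomorphic_trans XY (concentrated_stalk Yc).
Qed.

Lemma stalk_iso (s : int) (M N : fgmod R) : mod_iso M N ->
  @isomorphic (Dsg R) (stalk s M) (stalk s N).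
Proof.
case=> f [g fg gf]; apply: (@quasi_iso_Dsg _ _ _ (stalk_map nR s f)).
apply: quasi_iso_bij => i.
  by move=> u v /(congr1 val) /= /(can_inj fg); apply: val_inj.
move=> u.
have h : stalk_pred (M := M) s i (g (val u)).
  by move=> si; apply: (can_inj fg); rewrite gf raddf0; apply: (submP u).
by exists (mk_subm (stalk_submod s M i) h); apply: val_inj; rewrite /= gf.
Qed.

(** The stalk complex of [P] is perfect. *)
Lemma stalk_syzygy1 (s : int) (K P M : fgmod R) (i : {linear K -> P})
    (p : {linear P -> M}) : projective P -> injective i -> exact_at i p -> surj p ->
  @isomorphic (Dsg R) (stalk s M) (stalk (s - 1) K).
Proof.
move=> Pp ii ip ps.
have E : ses (stalk_map nR s i) (stalk_map nR s p).
  move=> j; split.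
  - by move=> u v /(congr1 val) /= /ii; apply: val_inj.
  - move=> u; split=> [/(congr1 val) /= /ip[x xu]|[v <-]]; last first.
      by apply: val_inj; rewrite /=; apply/ip; exists (val v).
    have h : stalk_pred (M := K) s j x.
      by move=> js; apply: ii; rewrite raddf0 xu; apply: (submP u).
    by exists (mk_subm (stalk_submod s K j) h); apply: val_inj.
  move=> u; have [e|/eqP js] := eqVneq j s; last first.
    by exists 0; rewrite raddf0 (stalk0 u js).
  have [x xu] := ps (val u).
  have h : stalk_pred (M := P) s j x by move=> js.
  by exists (mk_subm (stalk_submod s P j) h); apply: val_inj.
apply: isomorphic_trans (ses_proj_middle E (@stalk_proj _ nR _ _ Pp)) _.
by apply: (@isomorphic_sym (Dsg R)); apply: stalk_shift.
Qed.

Lemma stalk_syzygy (n : nat) (s : int) (M K : fgmod R) : is_syzygy n M K ->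
  @isomorphic (Dsg R) (stalk s M) (stalk (s - n%:Z) K).
Proof.
elim: n K => [|n IH] K /=; first by rewrite subr0; apply: stalk_iso.
move=> [M' [P [i [p [/IH h [Pp ps _] ii ip]]]]].
apply: isomorphic_trans h _.
by rewrite -addn1 PoszD opprD addrA; apply: stalk_syzygy1 Pp ii ip ps.
Qed.

End Reduction.

(** * Generation by a stalk complex *)

Section AdditiveClosure.
Variable R : pzRingType.

Definition biprod (A B S : lmodType R) (i : {linear A -> S}) (j : {linear B -> S})
    (p : {linear S -> A}) (q : {linear S -> B}) : Prop :=
  [/\ forall x, p (i x) = x, forall y, q (j y) = y, forall y, p (j y) = 0,
    forall x, q (i x) = 0 & forall s, i (p s) + j (q s) = s].

Section Prod.
Variables A B : fgmod R.
Lemma pinl_linear : linear (fun x : A => (x, 0) : fg_prod A B).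
Proof. by move=> a u v; congr pair; rewrite /= scaler0 addr0. Qed.
Definition pinl : {linear A -> fg_prod A B} :=
  HB.pack (fun x : A => (x, 0) : fg_prod A B) (GRing.isLinear.Build _ _ _ _ _ pinl_linear).
Lemma pinr_linear : linear (fun x : B => (0, x) : fg_prod A B).
Proof. by move=> a u v; congr pair; rewrite /= scaler0 addr0. Qed.
Definition pinr : {linear B -> fg_prod A B} :=
  HB.pack (fun x : B => (0, x) : fg_prod A B) (GRing.isLinear.Build _ _ _ _ _ pinr_linear).
Definition pfst : {linear fg_prod A B -> A} := fst.
Definition psnd : {linear fg_prod A B -> B} := snd.
Lemma prod_biprod : biprod pinl pinr pfst psnd.
Proof. by split=> // -[x y]; congr pair; rewrite /= ?addr0 ?add0r. Qed.
End Prod.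

(** Iterated pairs, instead of functions on ['I_r], let coproducts of [r] copies be
    built one copy at a time. *)
Fixpoint pow (V : fgmod R) (r : nat) : fgmod R :=
  if r is r'.+1 then fg_prod V (pow V r') else zero_fg R.

Lemma pow_iso (V : fgmod R) r : mod_iso {ffun 'I_r -> V} (pow V r).
Proof.
elim: r => [|r [f [f' ff' f'f]]] /=.
  exists \0, (fun=> 0) => x; first by apply/ffunP => -[].
  by rewrite [RHS]zero_fgE.
pose g (x : {ffun 'I_r.+1 -> V}) : fg_prod V (pow V r) :=
  (x ord0, f [ffun a => x (lift ord0 a)]).
have glin : linear g.
  move=> a u v; rewrite /g; congr pair; first by rewrite !ffunE.
  rewrite -[RHS]/(a *: f _ + f _) -linearP; congr (GRing.Linear.sort f _).
  by apply/ffunP => b; rewrite !ffunE.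
pose g' (z : fg_prod V (pow V r)) : {ffun 'I_r.+1 -> V} :=
  [ffun a => if unlift ord0 a is Some b then f' z.2 b else z.1].
exists (HB.pack_for {linear {ffun 'I_r.+1 -> V} -> fg_prod V (pow V r)} g
  (GRing.isLinear.Build _ _ _ _ g glin)); exists g' => [x|[x y]] /=.
  apply/ffunP => a; rewrite ffunE /= ff'.
  by case: unliftP => [b|] ->; rewrite ?ffunE.
rewrite /g /g' !ffunE unlift_none; congr pair.
rewrite -[RHS]f'f; congr (GRing.Linear.sort f _); apply/ffunP => b; rewrite !ffunE.
by rewrite liftK.
Qed.

(** Membership in [add V] in equational form, which any additive functor
    preserves. *)
Definition split_in (V X : fgmod R) : Prop :=
  exists (r : nat) (Y : fgmod R) (i : {linear X -> pow V r}) (j : {linear Y -> pow V r})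
    (p : {linear pow V r -> X}) (q : {linear pow V r -> Y}), biprod i j p q.

Lemma in_add_split (V X : fgmod R) : in_add V X -> split_in V X.
Proof.
case=> r [Y /mod_isoP[f [f' [ff' f'f]]]].
have [g [g' [gg' g'g]]] := mod_isoP (pow_iso V r).
pose h : {linear pow V r -> fg_prod X Y} := f' \o g'.
exists r, Y, (g \o (f \o pinl X Y)), (g \o (f \o pinr X Y)), (pfst X Y \o h), (psnd X Y \o h).
split=> [x|y|y|x|s]; rewrite /= ?gg' ?ff' //.
rewrite -!linearD /=.
have -> : (((f' (g' s)).1, 0) : X * Y) + (0, (f' (g' s)).2) = f' (g' s).
  by case: (f' (g' s)) => x y; congr pair; rewrite /= ?addr0 ?add0r.
by rewrite f'f g'g.
Qed.

Lemma split_in_iso (V X X' : fgmod R) : mod_iso X X' -> split_in V X -> split_in V X'.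
Proof.
case/mod_isoP=> f [f' [ff' f'f]] [r [Y [i [j [p [q [pi qj pj qi e]]]]]]].
exists r, Y, (i \o f'), j, (f \o p), q; split=> //=.
- by move=> x; rewrite pi f'f.
- by move=> y; rewrite pj raddf0.
- by move=> s; rewrite ff' e.
Qed.

End AdditiveClosure.

Section Generation.
Variables (T : tricat).

Lemma gen1_iso (I : T -> Prop) (X X' : T) : isomorphic X X' -> gen1 I X' -> gen1 I X.
Proof.
case=> e ei [r [M [n [S [i [IM iP [Y [a [b ab]]]]]]]]].
exists r, M, n, S, i; split=> //; exists Y, (idm S oo a oo e), (idm S oo b oo idm Y).
by apply: coprod2_iso => //; apply: is_iso_idm.
Qed.

Lemma gen_iso (I : T -> Prop) n (X X' : T) :
  isomorphic X X' -> gen I n.+1 X' -> gen I n.+1 X.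
Proof. by case: n => [|n]; apply: gen1_iso. Qed.
End Generation.

Section Main.
Variables (R : pzRingType) (nR : noetherian R).
Local Notation stalk := (stalk nR).

Lemma sh0_iso (X : cpx R) : @isomorphic (Dsg R) X (sh_cpx 0 X).
Proof.
have trd i j x : tr X j (j + 0) (cd X i j x) = cd (sh_cpx 0 X) i j (tr X i (i + 0) x).
  by rewrite /= /sh_d /=; apply: tr_d; rewrite addr0.
apply: (@quasi_iso_Dsg _ _ _ (@ChMap R X (sh_cpx 0 X) (fun i => tr X i (i + 0)) trd)).
have K (i j : int) : i = j -> cancel (tr X i j) (tr X j i).
  by move=> -> x; rewrite !tr_id.
apply: quasi_iso_bij => i; first by apply: (can_inj (K _ _ _)); rewrite addr0.
by move=> y; exists (tr X (i + 0) i y); apply: K; rewrite addr0.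
Qed.

(** An object is a summand of the coproduct of the one-member family of its zeroth
    shift, with a zero complement. *)
Lemma gen1_incl (I : Dsg R -> Prop) (X : Dsg R) : I X -> gen1 I X.
Proof.
move=> IX; have [e ei] := isomorphic_sym (sh0_iso X).
exists 1%N, (fun=> X), (fun=> 0), X, (fun=> e); split=> //.
  exact: coprod1.
exists (zero_cpx R : Dsg R), (idm X), (toDsg (toDb (zero_map X))).
exact: coprod2_initial (@Dsg_initial R).
Qed.

Lemma stalk_coprod2 c (A B S : fgmod R) (i : {linear A -> S}) (j : {linear B -> S})
    (p : {linear S -> A}) (q : {linear S -> B}) : biprod i j p q ->
  @is_coprod2 (Dsg R) _ _ _ (toDsg (toDb (stalk_map nR c i)))
    (toDsg (toDb (stalk_map nR c j))).
Proof.
case=> pi qj pj qi e; apply: Dsg_coprod2.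
apply: (@split_coprod2 _ _ _ _ _ _ (stalk_map nR c p) (stalk_map nR c q)) => n x;
  by apply: val_inj; rewrite /= ?pi ?qj ?pj ?qi ?e.
Qed.

Lemma stalk_coprod c (V : fgmod R) r :
  exists i : forall a : 'I_r, @hom (Dsg R) (stalk c V) (stalk c (pow V r)),
    is_coprod i.
Proof.
elim: r => [|r [i iP]].
  pose e (X : Dsg R) := toDsg (toDb (zero_map X)).
  have z0 : @isomorphic (Dsg R) (zero_cpx R) (stalk c (zero_fg R)).
    apply: (@quasi_iso_Dsg _ _ _ (zero_map _)); apply: quasi_iso_bij => n.
      by move=> x y _; rewrite (zero_fgE x) (zero_fgE y).
    by move=> y; exists 0; apply: val_inj; rewrite [RHS]zero_fgE.
  have [f [g [gf fg]]] := z0.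
  exists (fun=> toDsg (toDb (stalk_map nR c \0))) => Z h.
  exists (e Z oo g); split=> [[]//|v _].
  by rewrite -[v]cmp1r -fg cmpA (Dsg_initial (v oo f)).
have P := @stalk_coprod2 c _ _ _ _ _ _ _ (prod_biprod V (pow V r)).
set j := toDsg _ in P; set k := toDsg _ in P.
exists (fun a => if unlift ord0 a is Some b then k oo i b else j).
apply: (coprodS (i := i) (j := j) (k := k)) => // [|a].
  by rewrite unlift_none.
by rewrite liftK.
Qed.

Lemma stalk_gen1 c (V X : fgmod R) : split_in V X ->
  gen1 (fun Y : Dsg R => Y = stalk 0 V) (stalk c X).
Proof.
case=> r [Y [i [j [p [q bp]]]]]; have [l lP] := stalk_coprod c V r.
have [e ei] := isomorphic_sym (stalk_shift nR (- c) 0 V).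
move: e ei; rewrite opprK add0r => e ei.
exists r, (fun=> stalk 0 V), (fun=> - c), (stalk c (pow V r)), (fun a => l a oo e).
split=> //; first exact: coprod_iso.
exists (stalk c Y), (toDsg (toDb (stalk_map nR c i))), (toDsg (toDb (stalk_map nR c j))).
exact: stalk_coprod2 bp.
Qed.

(** The bottom term of the complex is a quotient with a brutal truncation as kernel.
    It has to be the bottom one: a layer is built from triangles with the lower
    layer on the left and a single step on the right. *)
Lemma brutal_gen (V : fgmod R) (m : nat) (c : int) (X : cpx R) :
  concentrated (c - m%:Z) c X -> (forall i, c - m%:Z <= i <= c -> split_in V (X i)) ->
  gen (fun Y : Dsg R => Y = stalk 0 V) m.+1 X.
Proof.
elim: m X => [|m IH] X Xc XV.
  apply: (gen1_iso (X' := stalk c (X c) : Dsg R)).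
    by apply: concentrated_stalk; rewrite subr0 in Xc.
  by apply: stalk_gen1; apply: XV; lia.
set b := c - m.+1%:Z in Xc XV.
have dX i x : (idfun : {linear X b -> X b}) (cd X i b x) = 0.
  have [e|/eqP ij] := eqVneq (i + 1) b; last exact: cd_shape.
  by rewrite (Xc i _ x) ?raddf0 //; lia.
pose S i (x : X i) := i = b -> x = 0.
have hS i : is_submod (@S i).
  split=> // [x y hx hy ib|a x hx ib]; first by rewrite hx // hy // addr0.
  by rewrite hx // scaler0.
have dS i j x : S i x -> S j (cd X i j x).
  move=> Sx jb; have [e|/eqP ij] := eqVneq (i + 1) j; last exact: cd_shape.
  by rewrite (Xc i _ x) ?raddf0 //; lia.
pose A := sub_cpx nR hS dS.
have E : ses (sub_inc nR hS dS) (to_stalk nR dX).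
  move=> i; split; first exact: val_inj.
  - move=> x; split=> [/(congr1 val) /= ex|[u <-]].
      have Sx : S i x by move=> ib; subst i; rewrite -ex tr_id.
      by exists (mk_subm (hS i) Sx).
    apply: val_inj; rewrite /=; have [ib|/eqP ib] := eqVneq i b.
      by rewrite (submP u ib) raddf0.
    by rewrite tr_ne.
  - move=> u; have [ib|/eqP ib] := eqVneq i b.
      by subst i; exists (val u); apply: val_inj; rewrite /= tr_id.
    by exists 0; rewrite raddf0 (stalk0 u ib).
have [h D] := ses_dist_Dsg E.
apply: gen1_incl; exists (A : Dsg R), (stalk b (X b) : Dsg R),
  (toDsg (toDb (sub_inc nR hS dS))), (toDsg (toDb (to_stalk nR dX))), h.
split=> //; last by apply: stalk_gen1; apply: XV; lia.
apply: IH => i hi.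
  apply: subm_zero => x Sx; have [ib|/eqP ib] := eqVneq i b; first exact: Sx.
  by apply: Xc; lia.
apply: split_in_iso (XV i _); last by lia.
by apply: subm_full => x ib; lia.
Qed.

(** ** Resolutions as complexes *)

Section Resolution.
Variables (m : nat) (K : fgmod R) (W : nat -> fgmod R)
  (d : forall i, {linear W i.+1 -> W i}) (e : {linear W 0 -> K}).
Hypotheses (W0 : forall i, (m < i)%N -> forall x : W i, x = 0)
  (dd : forall i, exact_at (d i.+1) (d i)) (de : exact_at (d 0) e) (es : surj e).

(** The transport between terms of the sequence, zero for distinct indices; it makes
    the differential of the complex below total in both degrees. *)
Definition trn p q : {linear W p -> W q} :=
  match p =P q with
  | ReflectT e => match e in _ = q0 return {linear W p -> W q0} with
                  | erefl => idfun
                  end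
  | ReflectF _ => \0
  end.
Lemma trn_id p x : trn p p x = x.
Proof. by rewrite /trn; case: eqP => // h; rewrite (eq_axiomK h). Qed.
Lemma trn_ne p q x : p <> q -> trn p q x = 0.
Proof. by rewrite /trn; case: eqP. Qed.

(* Positive degrees carry the zero module [W m.+1]. *)
Definition res_idx (i : int) : nat :=
  match i with Posz 0 => 0 | Posz _.+1 => m.+1 | Negz n => n.+1 end.
Definition res_ob i := W (res_idx i).
Definition res_d i j : {linear res_ob i -> res_ob j} :=
  if i + 1 == j
  then (d (res_idx j) \o trn (res_idx i) (res_idx j).+1 : {linear res_ob i -> res_ob j})
  else (\0 : {linear res_ob i -> res_ob j}).
Lemma res_shape i j : i + 1 <> j -> forall x, res_d i j x = 0.
Proof. by rewrite /res_d; case: eqP. Qed.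
Lemma d_trn p q r x : d r (trn q r.+1 (d q (trn p q.+1 x))) = 0.
Proof.
have [e1|/eqP h] := eqVneq q r.+1; last by rewrite (trn_ne _ h) raddf0.
by subst q; rewrite trn_id; apply/dd; eexists.
Qed.
Lemma res_sq i j k x : res_d j k (res_d i j x) = 0.
Proof.
rewrite /res_d; case: eqP => _ //; case: eqP => _; last by rewrite raddf0.
exact: d_trn.
Qed.
Lemma res_zero i : 0 < i -> forall x : res_ob i, x = 0.
Proof. by case: i => [[|n]|n] // _; apply: W0. Qed.
Lemma res_conc i : (i < 0 - m%:Z) || (0 < i) -> forall x : res_ob i, x = 0.
Proof.
case/orP => [hi|/res_zero //].
by apply: W0; case: i hi => [[|n]|n] /=; lia.
Qed.
Lemma res_bnd : exists N : nat, forall i : int, (N < `|i|)%N ->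
  forall x : res_ob i, x = 0.
Proof. by exists m => i hi; apply: res_conc; lia. Qed.
Definition res : cpx R := Cpx res_shape res_sq res_bnd.

Lemma res_e i x : (e : {linear res 0 -> K}) (cd res i 0 x) = 0.
Proof.
have [i1|/eqP i1] := eqVneq (i + 1) 0; last by rewrite cd_shape ?raddf0.
have hi : i = Negz 0 by lia.
by subst i; rewrite /= /res_d /= trn_id; apply/de; eexists.
Qed.

(* Exactness in degree [j], where the augmentation [e] takes the role of the
   differential for [j = 0]. *)
Lemma res_exact i j (a : res j) : i + 1 = j ->
  (forall k, j + 1 = k -> cd res j k a = 0) -> (forall (h : j = 0),
     e (tr res j 0 a) = 0) -> exists a', cd res i j a' = a.
Proof.
case: j a => [[|j]|j] a ij da ea.
- have hi : i = Negz 0 by lia.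
  subst i; have := ea erefl; rewrite tr_id => /de[a' <-].
  by exists a'; rewrite /= /res_d /= trn_id.
- by exists 0; rewrite raddf0 (W0 _ a).
have hi : i = Negz j.+1 by lia.
subst i; have {da} : d j a = 0.
  case: j a ij ea da => [|j] a _ _ da.
    by have := da 0 erefl; rewrite /= /res_d /= trn_id.
  have jj : Negz j.+1 + 1 = Negz j by lia.
  have := da (Negz j) jj; rewrite /= /res_d.
  by case: eqP => // _; rewrite /= trn_id.
case/dd => a' <-; exists a'; rewrite /= /res_d; case: eqP => [_|[]]; last lia.
by rewrite /= trn_id.
Qed.

Lemma res_stalk : @isomorphic (Dsg R) (stalk 0 K) res.
Proof.
apply: (@isomorphic_sym (Dsg R)).
apply: (@quasi_iso_Dsg _ _ _ (to_stalk nR (phi := e : {linear res 0 -> K}) res_e)).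
apply: quasi_iso_surj => i.
  move=> u; have [i0|/eqP i0] := eqVneq i 0; last first.
    by exists 0; rewrite raddf0 (stalk0 u i0).
  subst i; have [x xu] := es (val u).
  by exists x; apply: val_inj; rewrite /= tr_id.
move=> a da fa; have [||a' a'a] := @res_exact i (i + 1) a erefl.
- by move=> k <-.
- by move=> h; have := congr1 val fa.
have [hi|hi] := boolP (0 <= i).
  by exists 0; rewrite raddf0 // (res_zero _ a) //; lia.
by exists a' => //; apply: stalk0; lia.
Qed.

End Resolution.

Theorem IT_tri_dim (m n : nat) : IT_algebra R m n ->
  exists M : Dsg R, forall X : Dsg R, gen (fun Y => Y = M) m.+1 X.
Proof.
case=> V VP; exists (stalk 0 V) => X.
have [a [M XM]] := reduce_stalk nR X.
have [K [MK [W [d [e [WV W0 dd de es]]]]]] := VP M.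
set s := a - n%:Z.
have Xs : @isomorphic (Dsg R) X (sh_cpx (- s) (res W0 dd)).
  apply: isomorphic_trans XM _.
  apply: isomorphic_trans (stalk_syzygy nR a MK) _.
  have := stalk_shift nR (- s) 0 K; rewrite opprK add0r => h.
  apply: isomorphic_trans h _.
  by apply: (@isomorphic_shm (Dsg R) (- s)); apply: res_stalk de es.
apply: gen_iso Xs _; apply: (@brutal_gen V m s).
  by move=> i hi; apply: (res_conc W0); lia.
move=> i hi; apply: in_add_split; apply: WV.
have {hi} : - m%:Z <= i - s <= 0 by lia.
by case: (i - s) => [[|k]|k] /=; lia.
Qed.

End Main.

(** * The dimension of the singularity category *)

Theorem theorem1p3 (k : comPzRingType) (L : algType k)
    (hL : artin_algebra L) :
  enat_le (tri_dim (Dsg L)) (IT_dist L).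
Proof.
rewrite /IT_dist /enat_inf; case: pselect => [h|_]; last by case: (tri_dim _).
case: ex_minnP => m /asboolP[n IT] _.
have gen := IT_tri_dim (artin_noetherian hL) IT.
rewrite /tri_dim /enat_inf; case: pselect => [h'|[]]; last first.
  by exists m; apply/asboolP.
by case: ex_minnP => d _ dmin; apply: dmin; apply/asboolP.
Qed.
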